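(* Let $S$ be a semigroup and let $\omega$ be a weight on $S$. Then the weighted semigroup algebra $\ell^1(S,\omega)$ is a dual Banach algebra with predual $c_0(S)$ if and only if $\frac{1_{st^{-1}}}{\omega}\in c_0(S)$ and $\frac{1_{t^{-1}s}}{\omega}\in c_0(S)$ for all $s,t\in S$.
   Context: A weight on a semigroup $S$ is a function $\omega:S\to(0,\infty)$ with $\omega(st)\le\omega(s)\omega(t)$ for all $s,t\in S$. The weighted semigroup algebra $\ell^1(S,\omega)$ is the Banach algebra of all $f=\sum_{s\in S}f(s)\delta_s$ ($f:S\to\mathbb C$, $\delta_s$ the point mass at $s$) with $\|f\|_{1,\omega}=\sum_{s\in S}|f(s)|\omega(s)<\infty$, with product $f*g=\sum_{r\in S}\bigl(\sum_{st=r}f(s)g(t)\bigr)\delta_r$ (empty sums are $0$). Its dual is $\ell^\infty(S,\omega)=\{\phi:S\to\mathbb C:\ \|\phi\|_{\infty,\omega}=\sup_{s\in S}|\phi(s)/\omega(s)|<\infty\}$ via $\langle\phi,f\rangle=\sum_{s\in S}\phi(s)f(s)$. $c_0(S)$ is the Banach space (sup norm) of functions on $S$ vanishing at infinity, where $S$ is discrete (for every $\epsilon>0$ the function has modulus $<\epsilon$ off a finite set). Put $c_0(S,\omega)=\{\phi\in\ell^\infty(S,\omega):\phi/\omega\in c_0(S)\}$; it is a closed subspace of $\ell^\infty(S,\omega)$ whose dual is $\ell^1(S,\omega)$ via the restricted pairing. For a Banach algebra $\mathfrak A$, the module actions on $\mathfrak A^*$ are $\langle f\cdot a,b\rangle=\langle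 f,ab\rangle$ and $\langle a\cdot f,b\rangle=\langle f,ba\rangle$ ($a,b\in\mathfrak A$, $f\in\mathfrak A^*$). A Banach algebra $\mathfrak A$ that is a dual Banach space with predual $\mathfrak A_*$ (regarded as a closed subspace of $\mathfrak A^*$) is a dual Banach algebra (with predual $\mathfrak A_*$) if $\mathfrak A_*$ is both a left and a right $\mathfrak A$-submodule of $\mathfrak A^*$, i.e. $a\cdot f\in\mathfrak A_*$ and $f\cdot a\in\mathfrak A_*$ for all $a\in\mathfrak A$, $f\in\mathfrak A_*$. ''$\ell^1(S,\omega)$ has predual $c_0(S)$'' is understood through the isometric isomorphism $c_0(S)\to c_0(S,\omega)$, $\psi\mapsto\psi\omega$ (i.e. the pairing $\langle\psi,f\rangle=\sum_s\psi(s)\omega(s)f(s)$); thus being a dual Banach algebra with predual $c_0(S)$ is the same as being one with predual $c_0(S,\omega)\subseteq\ell^\infty(S,\omega)$. For $s,t\in S$: $t^{-1}s=\{r\in S: tr=s\}$ and $st^{-1}=\{r\in S: rt=s\}$. $1_F$ denotes the characteristic function of $F\subseteq S$. *)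

(* Defs.v *)
From HB Require Import structures.
From mathcomp Require Import all_boot all_order all_algebra finmap.
From mathcomp Require Import complex.
From mathcomp Require Import all_classical all_reals all_analysis.
From mathcomp.analysis Require Import showcase.summability.

Set Implicit Arguments.
Unset Strict Implicit.
Unset Printing Implicit Defensive.

Import Order.TTheory GRing.Theory Num.Theory.
Import numFieldNormedType.Exports.
Import ComplexField.Normc.

Notation cabs := (@ComplexField.Normc.normc _).

Local Open Scope classical_set_scope.
Local Open Scope ring_scope.

(* Without this instance, [R[i]] is only known as a normed module through [R[i]^o]. *)
HB.instance Definition _ (R : realType) := NormedModule.copy R[i] R[i]^o.

#[global] Existing Instance summability.totally_filter.

Lemma fset_memE (I : choiceType) (A B : {fset I}) :
  (A `<=` B)%fset -> [fset x in B | mem A x]%fset = A.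
Proof.
move=> AB; apply/fsetP => x; rewrite !inE/= andbC.
by case: (boolP (x \in A)) => //= /(fsubsetP AB) ->.
Qed.

Section RealSums.
Variables (R : realType) (I : choiceType).
Implicit Types (a b : I -> R) (B : {fset I}).

Definition rsummable a := (\esum_(i in [set: I]) (a i)%:E < +oo)%E.
Definition rsum a : R := fine (\esum_(i in [set: I]) (a i)%:E)%E.

Lemma rsum_ge0 a : (forall i, 0 <= a i) -> 0 <= rsum a.
Proof. by move=> a0; apply: fine_ge0; apply: esum_ge0 => i _; rewrite lee_fin. Qed.

Lemma esum_rsum a : (forall i, 0 <= a i) -> rsummable a ->
  (\esum_(i in [set: I]) (a i)%:E = (rsum a)%:E)%E.
Proof.
move=> a0 ha; rewrite /rsum fineK// ge0_fin_numE//.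
by apply: esum_ge0 => i _; rewrite lee_fin.
Qed.

Lemma fset_fsumE B a :
  (\sum_(i \in [set` B]) (a i)%:E = (\sum_(i <- B) a i)%:E)%E.
Proof. by rewrite fsbig_finite//= set_fsetK -sumEFin. Qed.

Lemma le_rsum a B : (forall i, 0 <= a i) -> rsummable a ->
  \sum_(i <- B) a i <= rsum a.
Proof.
move=> a0 ha; rewrite -lee_fin -esum_rsum// -fset_fsumE.
by apply: esum_ge; exists [set` B].
Qed.

Lemma rsum_le a (M : R) : (forall i, 0 <= a i) ->
  (forall B, \sum_(i <- B) a i <= M) -> rsummable a /\ rsum a <= M.
Proof.
move=> a0 hM.
have h : (\esum_(i in [set: I]) (a i)%:E <= M%:E)%E.
  apply: ge_ereal_sup => _ [X [finX _]] <-.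
  by rewrite -(fset_setK finX) fset_fsumE lee_fin.
have ha : rsummable a by apply: le_lt_trans h _; rewrite ltry.
by split => //; rewrite -lee_fin -esum_rsum.
Qed.

Lemma rsum_gt a (e : R) : (forall i, 0 <= a i) -> rsummable a -> 0 < e ->
  exists B, rsum a - e < \sum_(i <- B) a i.
Proof.
move=> a0 ha e0; apply: contrapT => /forallNP h.
have [_] : rsummable a /\ rsum a <= rsum a - e.
  by apply: rsum_le => // B; rewrite leNgt; apply/negP/h.
by rewrite -subr_ge0 addrAC subrr add0r oppr_ge0 leNgt e0.
Qed.

Lemma ler_rsum a b : (forall i, 0 <= a i <= b i) -> rsummable b ->
  rsummable a /\ rsum a <= rsum b.
Proof.
move=> ab hb.
have a0 i : 0 <= a i by case/andP: (ab i).
have b0 i : 0 <= b i by apply: le_trans (a0 i) _; case/andP: (ab i).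
apply: rsum_le => // B; apply: le_trans (le_rsum B b0 hb).
by apply: ler_sum => i _; case/andP: (ab i).
Qed.

Lemma rsumD a b : (forall i, 0 <= a i) -> (forall i, 0 <= b i) ->
  rsummable a -> rsummable b ->
  rsummable (fun i => a i + b i) /\
  rsum (fun i => a i + b i) <= rsum a + rsum b.
Proof.
move=> a0 b0 ha hb; apply: rsum_le => [i|B]; first exact: addr_ge0.
by rewrite big_split lerD// le_rsum.
Qed.

Lemma rsumZ (c : R) a : 0 <= c -> (forall i, 0 <= a i) -> rsummable a ->
  rsummable (fun i => c * a i) /\ rsum (fun i => c * a i) = c * rsum a.
Proof.
move=> c0 a0 ha.
have le d a' : 0 <= d -> (forall i, 0 <= a' i) -> rsummable a' ->
    rsummable (fun i => d * a' i) /\ rsum (fun i => d * a' i) <= d * rsum a'.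
  move=> d0 a'0 ha'; apply: rsum_le => [i|B]; first exact: mulr_ge0.
  by rewrite -mulr_sumr ler_wpM2l// le_rsum.
have [h1 h2] := le _ _ c0 a0 ha; split => //; apply/le_anti/andP; split => //.
have [->|cn0] := eqVneq c 0.
  by rewrite mul0r; apply: rsum_ge0 => i; rewrite mul0r.
have cp : 0 < c by rewrite lt_neqAle eq_sym cn0.
have ca0 i : 0 <= c * a i by exact: mulr_ge0.
have [_] := le c^-1 _ (ltW (etrans (invr_gt0 c) cp)) ca0 h1.
under [X in rsum X]eq_fun => i do rewrite mulKf//.
by rewrite ler_pdivlMl// mulrC.
Qed.

End RealSums.

Section ComplexScalars.
Variable R : realType.
Local Notation C := (R[i]).

Lemma normCE (z : C) : `|z| = (cabs z)%:C%C. Proof. by []. Qed.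

Lemma normc_ge0 (z : C) : 0 <= cabs z.
Proof. by case: z => x y; rewrite sqrtr_ge0. Qed.

Lemma normc_leD (y z : C) : cabs (y + z) <= normc y + cabs z.
Proof. exact: le_normcD. Qed.

Lemma normc_sum (I : Type) (r : seq I) (P : pred I) (a : I -> C) :
  cabs (\sum_(i <- r | P i) a i) <= \sum_(i <- r | P i) cabs (a i).
Proof.
elim/big_rec2 : _ => [|i y z _ h]; first by rewrite normc0.
by apply: le_trans (normc_leD _ _) _; rewrite lerD2l.
Qed.

Lemma normc_real (x : R) : cabs x%:C%C = `|x|.
Proof. by rewrite /= expr0n/= addr0 sqrtr_sqr. Qed.

Lemma le_Re_normc (z : C) : `|complex.Re z| <= cabs z.
Proof.
case: z => x y /=; rewrite -sqrtr_sqr ler_sqrt ?lerDl ?sqr_ge0//.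
by rewrite addr_ge0 ?sqr_ge0.
Qed.

Lemma le_Im_normc (z : C) : `|complex.Im z| <= cabs z.
Proof.
case: z => x y /=; rewrite -sqrtr_sqr ler_sqrt ?lerDr ?sqr_ge0//.
by rewrite addr_ge0 ?sqr_ge0.
Qed.

Lemma normc_le_ReIm (z : C) : cabs z <= `|complex.Re z| + `|complex.Im z|.
Proof.
case: z => x y /=; rewrite -[leRHS]ger0_norm ?addr_ge0// -sqrtr_sqr.
rewrite ler_sqrt ?sqr_ge0// sqrrD !real_normK ?num_real//.
by rewrite -addrA lerD2l lerDr mulrn_wge0// mulr_ge0.
Qed.

Lemma ltcR (x y : R) : (x%:C%C < y%:C%C :> C) = (x < y).
Proof. by rewrite ltcE/= eqxx. Qed.

Lemma lecR' (x y : R) : (x%:C%C <= y%:C%C :> C) = (x <= y).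
Proof. by rewrite lecE/= eqxx. Qed.

Lemma gt0_complexP (e : C) : 0 < e -> exists2 d : R, 0 < d & e = d%:C%C.
Proof.
case: e => x y; rewrite ltcE/= => /andP[/eqP -> x0]; by exists x.
Qed.

Lemma complex_complete (F : set_system C) : ProperFilter F -> cauchy F -> cvg F.
Proof.
move=> FF /cauchy_ballP Fc.
have part (p : C -> R) : (forall y z, p (y - z) = p y - p z) ->
    (forall z, `|p z| <= cabs z) -> cvg (p @ F).
  move=> pB pn; apply/cauchy_cvgP/cauchy_ballP => e e0.
  have e0' : 0 < e%:C%C :> C by rewrite (ltcR 0).
  have [[A B] /= [FA FB] AB] := Fc _ e0'.
  exists (p @` A, p @` B) => /=.
    by split; [apply: filterS FA|apply: filterS FB] => z Az; exists z.
  move=> [x y] /= [[u Au <-] [v Bv <-]].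
  rewrite -ball_normE/= -pB; apply: le_lt_trans (pn _) _.
  by have := AB (u, v) (conj Au Bv); rewrite -ball_normE/= normCE ltcR.
have /cvg_ex[/= u hu] := part (@complex.Re R) (fun y z => raddfB _ y z) le_Re_normc.
have /cvg_ex[/= v hv] := part (@complex.Im R) (fun y z => raddfB _ y z) le_Im_normc.
apply/cvg_ex; exists (u +i* v)%C.
apply/cvgrPdist_lt => _ /gt0_complexP[e e0 ->].
move/cvgrPdist_lt : hu => /(_ (e / 2) ltac:(by rewrite divr_gt0)) hu.
move/cvgrPdist_lt : hv => /(_ (e / 2) ltac:(by rewrite divr_gt0)) hv.
near=> z; rewrite normCE ltcR; apply: le_lt_trans (normc_le_ReIm _) _.
rewrite [e in _ < e]splitr ltrD//=.
  by rewrite raddfB /=; near: z; exact: hu.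
by rewrite raddfB /=; near: z; exact: hv.
Unshelve. all: by end_near. Qed.

Variable I : choiceType.
Implicit Types (a : I -> C) (B : {fset I}).

Lemma partial_sumE a B : partial_sum a B = \sum_(i <- B) a i.
Proof. by rewrite /partial_sum big_seq_fsetE. Qed.

Lemma normc_sum_fsetD a A B : rsummable (cabs \o a) -> (A `<=` B)%fset ->
  cabs (\sum_(i <- B) a i - \sum_(i <- A) a i) <=
  rsum (cabs \o a) - \sum_(i <- A) cabs (a i).
Proof.
move=> ha AB.
have n0 i : 0 <= (cabs \o a) i by exact: normc_ge0.
have split_ (V : zmodType) (b : I -> V) :
    \sum_(i <- B) b i - \sum_(i <- A) b i = \sum_(i <- (B `\` A)%fset) b i.
  have eD : [fset x in B | ~~ mem A x]%fset = (B `\` A)%fset.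
    by apply/fsetP => x; rewrite !inE/= andbC.
  by rewrite (big_fsetID _ (mem A) B) (fset_memE AB) eD addrAC subrr add0r.
rewrite split_; apply: le_trans (normc_sum _ _ _) _.
by rewrite -split_ lerD2r (le_rsum _ n0).
Qed.

Lemma sum_cvg a : rsummable (cabs \o a) -> cvg (partial_sum a @ totally).
Proof.
move=> ha; apply: complex_complete; apply: cauchy_exP.
move=> _ /gt0_complexP[e e0 ->].
have n0 i : 0 <= (cabs \o a) i by exact: normc_ge0.
have [A hA] := rsum_gt n0 ha e0.
exists (\sum_(i <- A) a i); exists A => // B /= AB.
rewrite partial_sumE -ball_normE/= distrC normCE ltcR.
apply: le_lt_trans (normc_sum_fsetD ha AB) _.
by rewrite ltrBlDl -ltrBlDr.
Qed.

Lemma normc_sum_le a : rsummable (cabs \o a) ->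
  cabs (summability.sum a) <= rsum (cabs \o a).
Proof.
move=> ha; apply/ler_addgt0Pr => e e0.
have n0 i : 0 <= (cabs \o a) i by exact: normc_ge0.
have e0' : 0 < e%:C%C :> C by rewrite (ltcR 0).
have /cvgrPdist_lt/(_ _ e0')[A _ /(_ A (fsubset_refl A))] := sum_cvg ha.
rewrite -/(summability.sum a) partial_sumE normCE ltcR => hA.
rewrite -[summability.sum a](subrK (\sum_(i <- A) a i)) addrC.
apply: le_trans (normc_leD _ _) _; apply: lerD (ltW hA).
by apply: le_trans (normc_sum _ _ _) _; exact: (le_rsum A n0 ha).
Qed.

End ComplexScalars.

Record weight (R : realType) (S : semigroupType) := Weight {
  wfun :> S -> R ;
  weight_gt0 : forall s, 0 < wfun s ;
  weight_submul : forall s t, wfun (s * t)%g <= wfun s * wfun t }.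

Section WeightedL1.
Variables (R : realType) (S : semigroupType) (w : weight R S).
Local Notation C := (R[i]).

Definition wabs (f : S -> C) (s : S) : R := cabs (f s) * w s.

Definition l1_pred : {pred S -> C} := [pred f | `[< rsummable (wabs f) >]].

Lemma l1_predP (f : S -> C) : reflect (rsummable (wabs f)) (f \in l1_pred).
Proof. exact: asboolP. Qed.

Lemma wabs_ge0 (f : S -> C) s : 0 <= wabs f s.
Proof. by rewrite mulr_ge0 ?normc_ge0// ltW// weight_gt0. Qed.

Lemma wabsD (f g : S -> C) s : wabs (f + g) s <= wabs f s + wabs g s.
Proof.
by rewrite -mulrDl ler_wpM2r ?normc_leD// ltW// weight_gt0.
Qed.

Lemma wabsZ (c : C) f : wabs (c *: f) = (fun s => cabs c * wabs f s).
Proof. by apply/funext => s; rewrite /wabs normcM mulrA. Qed.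

Lemma wabsN (f : S -> C) : wabs (- f) = wabs f.
Proof. by apply/funext => s; rewrite /wabs normcN. Qed.

Lemma wabs0 : wabs 0 = fun=> 0.
Proof. by apply/funext => s; rewrite /wabs normc0 mul0r. Qed.

Lemma wabs_addr (f g : S -> C) : f \in l1_pred -> g \in l1_pred ->
  f + g \in l1_pred /\ rsum (wabs (f + g)) <= rsum (wabs f) + rsum (wabs g).
Proof.
move=> /l1_predP hf /l1_predP hg.
have [h1 h2] := rsumD (wabs_ge0 f) (wabs_ge0 g) hf hg.
have [|h3 h4] := @ler_rsum _ _ (wabs (f + g)) _ _ h1.
  by move=> s; rewrite wabs_ge0 wabsD.
by split; [exact/l1_predP|exact: le_trans h4 h2].
Qed.

Lemma l1_submod_closed : GRing.subsemimod_closed l1_pred.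
Proof.
split; first split.
- apply/l1_predP; rewrite wabs0 /rsummable.
  by rewrite esum1 ?ltry// => s _.
- by move=> f g fl gl; have [] := wabs_addr fl gl.
- move=> c f /l1_predP fl; apply/l1_predP; rewrite wabsZ.
  by have [] := rsumZ (normc_ge0 c) (wabs_ge0 f) fl.
Qed.

HB.instance Definition _ :=
  GRing.isSubmodClosed.Build C (S -> C) l1_pred l1_submod_closed.

Record l1 := L1 { l1_fun :> S -> C ; l1_funP : l1_fun \in l1_pred }.

HB.instance Definition _ := [isSub for l1_fun].
HB.instance Definition _ := [Choice of l1 by <:].
HB.instance Definition _ := [SubChoice_isSubLmodule of l1 by <:].

Definition l1_norm (f : l1) : R := rsum (wabs f).

Lemma l1_normP (f : l1) : rsummable (wabs f).
Proof. exact/l1_predP/l1_funP. Qed.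

Definition l1_normC (f : l1) : C := (l1_norm f)%:C%C.

Lemma l1_ler_normD (f g : l1) : l1_normC (f + g) <= l1_normC f + l1_normC g.
Proof.
rewrite -rmorphD lecR'.
by have [] := wabs_addr (l1_funP f) (l1_funP g).
Qed.

Lemma l1_normrZ (c : C) (f : l1) :
  l1_normC (c *: f) = `|c| * l1_normC f.
Proof.
rewrite normCE -rmorphM; congr (_%:C)%C; rewrite /l1_norm wabsZ.
by have [] := rsumZ (normc_ge0 c) (wabs_ge0 f) (l1_normP f).
Qed.

Lemma wabs_le_norm (f : l1) s : wabs f s <= l1_norm f.
Proof.
have := le_rsum [fset s]%fset (wabs_ge0 f) (l1_normP f).
by rewrite big_seq_fset1.
Qed.

Lemma l1_normr0_eq0 (f : l1) : l1_normC f = 0 -> f = 0.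
Proof.
move=> [f0]; apply/val_inj/funext => s /=; apply: eq0_normc.
have := wabs_le_norm f s; rewrite f0 /wabs pmulr_lle0 ?weight_gt0// => h.
by apply/le_anti; rewrite h normc_ge0.
Qed.

HB.instance Definition _ := Lmodule_isNormed.Build C l1
  l1_ler_normD l1_normrZ l1_normr0_eq0.

Lemma l1_normE (f : l1) : `|f| = (l1_norm f)%:C%C.
Proof. by []. Qed.

Lemma l1_complete (F : set_system l1) : ProperFilter F -> cauchy F -> cvg F.
Proof.
move=> FF /cauchy_ballP Fc.
have Fball (e : R) : 0 < e ->
    exists A, F A /\ forall f g, A f -> A g -> l1_norm (f - g) < e.
  move=> e0; have e0' : 0 < e%:C%C :> C by rewrite (ltcR 0).
  have [[A B] /= [FA FB] AB] := Fc _ e0'.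
  exists (A `&` B); split; first exact: filterI.
  move=> f g [Af _] [_ Bg]; have := AB (f, g) (conj Af Bg).
  by rewrite -ball_normE/= l1_normE ltcR.
have pt s : cvg ((fun f : l1 => f s) @ F).
  apply: complex_complete; apply/cauchy_ballP => _ /gt0_complexP[e e0 ->].
  have [A [FA hA]] := Fball (e * w s) (mulr_gt0 e0 (weight_gt0 w s)).
  set ev := (fun f : l1 => f s).
  have FE : F (ev @^-1` (ev @` A)) by apply: filterS FA => f Af; exists f.
  exists (ev @` A, ev @` A) => //.
  move=> [_ _] [/= [f Af <-] [g Ag <-]].
  rewrite -ball_normE/= normCE ltcR -(ltr_pM2r (weight_gt0 w s)).
  exact: le_lt_trans (wabs_le_norm (f - g) s) (hA _ _ Af Ag).
pose h s : C := lim ((fun f : l1 => f s) @ F).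
have key (e : R) A : 0 < e -> F A ->
    (forall f g, A f -> A g -> l1_norm (f - g) < e) -> forall f, A f ->
    rsummable (wabs (h - l1_fun f)) /\ rsum (wabs (h - l1_fun f)) <= e.
  move=> e0 FA hA f Af; apply: rsum_le => [s|B]; first exact: wabs_ge0.
  apply/ler_addgt0Pr => d d0.
  pose M := \sum_(s <- B) w s.
  have M0 : 0 <= M by apply: sumr_ge0 => s _; rewrite ltW// weight_gt0.
  pose d' := d / (M + 1).
  have d'0 : 0 < d' by rewrite divr_gt0// ltr_wpDl.
  have d'0' : 0 < d'%:C%C :> C by rewrite (ltcR 0).
  have near_h : F [set g : l1 | forall s, s \in B -> cabs (h s - g s) < d'].
    have : forall s, s \in B -> F [set g : l1 | cabs (h s - g s) < d'].
      move=> s _; have /cvgrPdist_lt/(_ _ d'0') := pt s.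
      by apply: filterS => g; rewrite normCE ltcR.
    move=> hB.
    rewrite (_ : [set g | _] = \bigcap_(s in [set` B])
      [set g : l1 | cabs (h s - g s) < d']).
      by apply: filter_bigI.
    by apply/seteqP; split => g /= hg s; apply: hg.
  have [g [Ag gB]] : exists g : l1, A g /\ (forall s, s \in B -> cabs (h s - g s) < d').
    by have [g [Ag gB]] := filter_ex (filterI FA near_h); exists g.
  have le1 s : s \in B -> wabs (h - l1_fun f) s <= wabs (g - f : l1) s + d' * w s.
    move=> sB; rewrite -mulrDl ler_wpM2r ?(ltW (weight_gt0 _ _))//.
    have -> : (h - l1_fun f) s = (g s - f s) + (h s - g s).
      by rewrite [RHS]addrC addrA subrK.
    by apply: le_trans (normc_leD _ _) _; rewrite lerD2l ltW// gB.
  rewrite big_seq; apply: le_trans (ler_sum _ le1) _.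
  rewrite -big_seq big_split/= lerD//.
    apply: le_trans (le_rsum B (wabs_ge0 (g - f : l1)) (l1_normP (g - f))) _.
    by apply/ltW/hA.
  rewrite -mulr_sumr -/M /d' mulrAC ler_pdivrMr ?ltr_wpDl// ler_pM2l//.
  by rewrite lerDl.
have hl : h \in l1_pred.
  have [A [FA hA]] := Fball 1 ltr01.
  have [f Af] := filter_ex FA.
  have [/l1_predP h1 _] := key 1 A ltr01 FA hA f Af.
  by have [] := wabs_addr h1 (l1_funP f); rewrite subrK.
apply/cvg_ex; exists (L1 hl).
apply/cvgrPdist_lt => _ /gt0_complexP[e e0 ->].
have e20 : 0 < e / 2 by rewrite divr_gt0.
have [A [FA hA]] := Fball (e / 2) e20.
apply: (filterS _ FA) => f Af; rewrite l1_normE ltcR.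
have [_] := key _ A e20 FA hA f Af.
by move/le_lt_trans; apply; rewrite ltr_pdivrMr// ltr_pMr// ltr1n.
Qed.

HB.instance Definition _ := Uniform_isComplete.Build l1 l1_complete.

End WeightedL1.

Section Convolution.
Variables (R : realType) (S : semigroupType) (w : weight R S).
Local Notation C := (R[i]).
Local Notation l1 := (l1 w).

(* [summability.sum] is the unconditional sum, i.e. the limit of the finite
   partial sums along the directed set of finite subsets of the index type. *)
Definition conv (f g : S -> C) (r : S) : C :=
  summability.sum (fun p : S * S =>
    if (p.1 * p.2)%g == r then f p.1 * g p.2 else 0).

Lemma conv_l1 (f g : l1) : conv f g \in l1_pred w.
Proof.
pose H (p : S * S) := wabs w f p.1 * wabs w g p.2.
have H0 p : 0 <= H p by rewrite mulr_ge0 ?wabs_ge0.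
have Hs : rsummable H.
  have [//|B|//] := @rsum_le _ _ H (l1_norm f * l1_norm g).
  pose B1 := [fset p.1 | p in B]%fset; pose B2 := [fset p.2 | p in B]%fset.
  apply: (@le_trans _ _ (\sum_(s <- B1) \sum_(t <- B2) H (s, t))).
    rewrite (pair_big_dep_cond _ _ (fun=> B2)).
    set D := Imfset.imfset2 _ _ _ _.
    have BD : (B `<=` D)%fset.
      apply/fsubsetP => -[s t] pB; apply/imfset2P.
      exists s; first by rewrite !inE andbT; apply/imfsetP; exists (s, t).
      exists t => //.
      by rewrite !inE andbT; apply/imfsetP; exists (s, t).
    rewrite (big_fsetID _ (mem B) D) (fset_memE BD)/=.
    under eq_bigr do rewrite [X in H X]surjective_pairing.
    by rewrite lerDl sumr_ge0.
  under eq_bigr do rewrite /H/= -mulr_sumr.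
  rewrite -mulr_suml ler_pM ?sumr_ge0// => [s _|s _||]; rewrite ?wabs_ge0//.
    exact: le_rsum (wabs_ge0 _ _) (l1_normP f).
  exact: le_rsum (wabs_ge0 _ _) (l1_normP g).
pose K r (p : S * S) := if (p.1 * p.2)%g == r then H p else 0.
have KH r p : 0 <= K r p <= H p.
  by rewrite /K; case: ifP => _; rewrite ?lexx ?H0.
pose k r (p : S * S) := if (p.1 * p.2)%g == r then f p.1 * g p.2 else 0.
have kK r p : w r * cabs (k r p) <= K r p.
  rewrite /k /K /H; case: eqP => [<-|_]; last by rewrite normc0 mulr0.
  rewrite normcM /wabs mulrACA mulrC ler_wpM2l ?weight_submul//.
  by rewrite mulr_ge0 ?normc_ge0.
have wV r : 0 <= (w r)^-1 by rewrite invr_ge0 ltW ?weight_gt0.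
have ks r : rsummable (cabs \o k r).
  have [KS _] := ler_rsum (KH r) Hs.
  have K0 p : 0 <= K r p by case/andP: (KH r p).
  have [wKS _] := rsumZ (wV r) K0 KS.
  have [|//] := @ler_rsum _ _ (cabs \o k r) _ _ wKS.
  by move=> p; rewrite normc_ge0/= ler_pdivlMl ?weight_gt0.
have wk r : wabs w (conv f g) r <= rsum (K r).
  have n0 p : 0 <= (cabs \o k r) p by exact: normc_ge0.
  have w0 : 0 <= w r by rewrite ltW ?weight_gt0.
  apply: (@le_trans _ _ (w r * rsum (cabs \o k r))).
    by rewrite /wabs mulrC ler_wpM2l//; exact: (normc_sum_le (ks r)).
  have [_ <-] := rsumZ w0 n0 (ks r).
  have [KS _] := ler_rsum (KH r) Hs.
  have [|//] := @ler_rsum _ _ (fun p => w r * (cabs \o k r) p) (K r) _ KS.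
  by move=> p; rewrite kK mulr_ge0.
apply/l1_predP.
have [//|B|//] := @rsum_le _ _ (wabs w (conv f g)) (rsum H).
  exact: wabs_ge0.
apply: le_trans (ler_sum _ (fun r _ => wk r)) _.
have K0 r p : 0 <= K r p by case/andP: (KH r p).
rewrite -lee_fin -sumEFin.
under eq_bigr => r _ do rewrite -(esum_rsum (K0 r) (ler_rsum (KH r) Hs).1).
rewrite -esum_sum; last by move=> p r _ _; rewrite lee_fin.
rewrite -(esum_rsum H0 Hs); apply: le_esum => p _.
rewrite sumEFin lee_fin.
have [pB|pB] := boolP ((p.1 * p.2)%g \in B).
  rewrite (big_fsetD1 _ pB)/= {1}/K eqxx big1_fset ?addr0// => r.
  by rewrite !inE /K => /andP[rp _] _; rewrite eq_sym (negPf rp).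
rewrite big1_fset// => r rB _; rewrite /K; case: eqP => // e.
by move: pB; rewrite e rB.
Qed.

Definition l1_mul (f g : l1) : l1 := L1 (conv_l1 f g).

Definition pairing (phi : S -> C) (f : l1) : C :=
  summability.sum (fun s => phi s * f s).

End Convolution.

Section DualBanachAlgebra.
Variables (R : realType) (A : completeNormedModType R[i]).
Local Notation C := (R[i]).
Implicit Types (mul : A -> A -> A) (f g : A -> C) (X : set (A -> C)).

Definition is_banach_algebra mul : Prop :=
  [/\ associative mul,
      forall a, linear (mul a),
      forall b, linear (mul^~ b) &
      forall a b, `|mul a b| <= `|a| * `|b|].

Definition topdual : set (A -> C) := [set f : A -> C | scalar f /\ continuous f].

(* The norm of A takes its values in the nonnegative reals of R[i]. *)
Definition opnorm f : R := sup [set cabs (f a) | a in [set a | `|a| <= 1]].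

Definition closed_subspace X : Prop :=
  [/\ X `<=` topdual,
      X 0,
      forall (c : C) f g, X f -> X g -> X (c *: f + g) &
      forall f, topdual f ->
        (forall e : R, 0 < e -> exists2 g, X g & opnorm (f - g) < e) -> X f].

Definition bounded_functional_on X (L : (A -> C) -> C) : Prop :=
  (forall (c : C) f g, X f -> X g -> L (c *: f + g) = c * L f + L g) /\
  (exists M : R, forall f, X f -> cabs (L f) <= M * opnorm f).

(* [a |-> (f |-> f a)] is an isometric isomorphism of [A] onto the dual of
   [X], the latter carrying the norm inherited from the dual of [A]. *)
Definition is_predual X : Prop :=
  [/\ closed_subspace X,
      forall a, complex.Re `|a| =
        sup [set cabs (f a) | f in [set f | X f /\ opnorm f <= 1]] &
      forall L, bounded_functional_on X L ->
        exists a, forall f, X f -> L f = f a].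

(* The module actions [a . f] and [f . a] on the dual. *)
Definition lact mul (a : A) f : A -> C := fun b => f (mul b a).
Definition ract mul f (a : A) : A -> C := fun b => f (mul a b).

Definition dual_banach_algebra mul X : Prop :=
  [/\ is_banach_algebra mul, is_predual X &
      forall a f, X f -> X (lact mul a f) /\ X (ract mul f a)].

End DualBanachAlgebra.

Section C0.
Variables (R : realType) (S : semigroupType).
Local Notation C := (R[i]).

Definition c0 : set (S -> C) := [set psi |
  forall e : R, 0 < e -> finite_set [set s | ~ (cabs (psi s) < e)]].

Definition divw (w : weight R S) (phi : S -> C) : S -> C :=
  fun s => phi s / (w s)%:C%C.

Definition linfw (w : weight R S) : set (S -> C) :=
  [set phi | has_ubound (range (fun s => cabs (divw w phi s)))].

Definition c0w (w : weight R S) : set (S -> C) :=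
  [set phi | linfw w phi /\ c0 (divw w phi)].

(* [c0w w] as a set of functionals on [l1 w]; it is identified with [c0] through
   the isometric isomorphism [psi |-> psi * w] from [c0] onto [c0w w]. *)
Definition c0w_functionals (w : weight R S) : set (l1 w -> C) :=
  @pairing R S w @` c0w w.

(* [s t^-1] and [t^-1 s]; S need not have inverses. *)
Definition rquot (s t : S) : set S := [set r | (r * t)%g = s].
Definition lquot (t s : S) : set S := [set r | (t * r)%g = s].

End C0.

Arguments c0w_functionals {R S} w _.

(* Main.v *)
(* Every bounded functional on l^1(S,w) is the pairing with its values on point
   masses, and phi/w vanishes at infinity iff phi is, for every epsilon,
   epsilon*w-close to a function of finite support; so c_0(S,w) is closed, it
   norms l^1(S,w) through finitely supported unimodular multiples of w, and its
   dual is l^1(S,w).  The module actions send the pairing with phi to the pairing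
   with t |-> sum_s phi(st) a(s) and its mirror image.  For phi = 1_{s} and a a
   point mass delta_t these functions are 1_{t^-1 s} and 1_{s t^-1}, which gives
   necessity; sufficiency follows by approximating phi and a by finite sums. *)
Require Import Defs.
From mathcomp Require Import all_boot all_order all_algebra finmap complex.
From mathcomp Require Import all_classical all_reals all_analysis.
From mathcomp.analysis Require Import showcase.summability.

Set Implicit Arguments.
Unset Strict Implicit.
Unset Printing Implicit Defensive.

Import Order.TTheory GRing.Theory Num.Theory.
Import numFieldNormedType.Exports.
Import ComplexField.Normc.

Local Open Scope classical_set_scope.
Local Open Scope ring_scope.

Notation csum := summability.sum.
Notation asummable a := (rsummable (cabs \o a)).

(** * Unconditional sums of absolutely summable complex families *)

Section ComplexSums.
Variable R : realType.
Local Notation C := (R[i]).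
Variable I : choiceType.
Implicit Types (a b : I -> C) (A B : {fset I}).

Lemma cabs_eq0 (z : C) : (forall e : R, 0 < e -> cabs z <= e) -> z = 0.
Proof.
move=> h; apply: eq0_normc; apply/le_anti; rewrite normc_ge0 andbT.
by apply/ler_addgt0Pr => e e0; rewrite add0r h.
Qed.

Lemma csum_unique a (z : C) :
  (forall e : R, 0 < e -> exists A, forall B, (A `<=` B)%fset ->
     cabs (z - \sum_(i <- B) a i) < e) -> csum a = z.
Proof.
move=> h; apply: cvg_lim; first exact: norm_hausdorff.
apply/cvgrPdist_lt => _ /gt0_complexP[e e0 ->].
have [A hA] := h e e0; exists A => // B /= AB.
by rewrite partial_sumE normCE ltcR hA.
Qed.

Lemma csum_approx a (e : R) : asummable a -> 0 < e ->
  exists A, forall B, (A `<=` B)%fset -> cabs (csum a - \sum_(i <- B) a i) < e.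
Proof.
move=> ha e0; have e0' : 0 < e%:C%C :> C by rewrite (ltcR 0).
have /cvgrPdist_lt/(_ _ e0')[A _ hA] := sum_cvg ha.
by exists A => B /hA; rewrite partial_sumE normCE ltcR.
Qed.

Lemma asummable_le a (b : I -> R) : (forall i, cabs (a i) <= b i) ->
  rsummable b -> asummable a /\ cabs (csum a) <= rsum b.
Proof.
move=> ab hb; have [|h1 h2] := @ler_rsum _ _ (cabs \o a) b _ hb.
  by move=> i; rewrite normc_ge0 ab.
by split=> //; apply: le_trans (normc_sum_le h1) h2.
Qed.

Lemma asummableD a b : asummable a -> asummable b ->
  asummable (a + b) /\ csum (a + b) = csum a + csum b.
Proof.
move=> ha hb; split.
  have [h1 _] := rsumD (fun i => normc_ge0 (a i)) (fun i => normc_ge0 (b i)) ha hb.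
  by have [] := asummable_le (fun i => normc_leD (a i) (b i)) h1.
apply: csum_unique => e e0; have e20 : 0 < e / 2 by rewrite divr_gt0.
have [A hA] := csum_approx ha e20; have [B hB] := csum_approx hb e20.
exists (A `|` B)%fset => D; rewrite fsubUset => /andP[/hA AD /hB BD].
rewrite big_split/= opprD addrACA; apply: le_lt_trans (normc_leD _ _) _.
by rewrite [e]splitr ltrD.
Qed.

Lemma asummableZ (c : C) a : asummable a ->
  asummable (c *: a) /\ csum (c *: a) = c * csum a.
Proof.
move=> ha; split.
  have [h1 _] := rsumZ (normc_ge0 c) (fun i => normc_ge0 (a i)) ha.
  have [|//] := @asummable_le (c *: a) _ _ h1.
  by move=> i /=; rewrite normcM.
apply: csum_unique => e e0.
have c0 : 0 < cabs c + 1 by rewrite ltr_wpDl ?normc_ge0.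
have [A hA] := csum_approx ha (divr_gt0 e0 c0).
exists A => B /hA; rewrite ltr_pdivlMr// => AB.
rewrite -mulr_sumr -mulrBr normcM; apply: le_lt_trans AB.
by rewrite mulrC ler_wpM2l ?normc_ge0 ?lerDl.
Qed.

Lemma asummableB a b : asummable a -> asummable b ->
  asummable (a - b) /\ csum (a - b) = csum a - csum b.
Proof.
move=> ha hb; rewrite -scaleN1r -[- csum b]mulN1r.
have [h1 <-] := asummableZ (-1) hb; exact: asummableD.
Qed.

Definition restr A a : I -> C := fun i => if i \in A then a i else 0.

(** The partial sums are constant along the finite sets containing [A], for [a] and for its moduli
    alike, which gives both the value and the summability. *)
Lemma csum_fset A a : (forall i, i \notin A -> a i = 0) ->
  asummable a /\ csum a = \sum_(i <- A) a i.
Proof.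
move=> aA.
have sumE (V : zmodType) (b : I -> V) B : (forall i, i \notin A -> b i = 0) ->
    (A `<=` B)%fset -> \sum_(i <- B) b i = \sum_(i <- A) b i.
  move=> bA AB; rewrite (big_fsetID _ (mem A) B) (fset_memE AB)/=.
  rewrite [X in _ + X]big1_fset ?addr0// => i.
  by rewrite !inE/= => /andP[_ /bA].
split; last first.
  apply: csum_unique => e e0; exists A => B AB.
  by rewrite (sumE _ _ B)// subrr normc0.
have [|B|//] := @rsum_le _ _ (cabs \o a) (\sum_(i <- A) cabs (a i)).
  by move=> i; exact: normc_ge0.
rewrite -(sumE _ (cabs \o a) (A `|` B)%fset) ?fsubsetUl//.
  rewrite (big_fsetID _ (mem B) (A `|` B)%fset) fset_memE ?fsubsetUr//=.
  by rewrite lerDl sumr_ge0// => i _; rewrite normc_ge0.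
by move=> i /aA /= ->; rewrite normc0.
Qed.

Lemma csum_restr A a : asummable (restr A a) /\ csum (restr A a) = \sum_(i <- A) a i.
Proof.
have [|h ->] := @csum_fset A (restr A a); first by move=> i /negPf; rewrite /restr => ->.
by split=> //; apply: eq_big_seq => i iA; rewrite /restr iA.
Qed.

Lemma csum1 (j : I) a : (forall i, i != j -> a i = 0) ->
  asummable a /\ csum a = a j.
Proof.
move=> h; have [|h1 ->] := @csum_fset [fset j]%fset a.
  by move=> i; rewrite inE => /h.
by rewrite big_seq_fset1.
Qed.

(** Take [A] whose moduli come within [e] of the total. What a finite set carries outside [A] is at
    most [e], since its union with [A] still sums to at most the total. *)
Lemma csum_tail a (e : R) : asummable a -> 0 < e ->
  exists A, asummable (a - restr A a) /\ rsum (cabs \o (a - restr A a)) <= e.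
Proof.
move=> ha e0; have n0 i : 0 <= (cabs \o a) i by exact: normc_ge0.
have [A hA] := rsum_gt n0 ha e0; exists A.
apply: rsum_le => [i|B]; first exact: normc_ge0.
rewrite ltrBlDr -ltrBlDl in hA; apply: le_trans (ltW hA).
rewrite lerBrDl; apply: le_trans (le_rsum (A `|` B)%fset n0 ha).
rewrite (big_fsetID _ (mem A) (A `|` B)%fset) fset_memE ?fsubsetUl//= lerD2l.
rewrite (big_fsetID _ (mem A) B)/= big1_fset ?add0r; last first.
  move=> i; rewrite !inE/= => /andP[_ iA] _.
  by rewrite /restr !fctE iA subrr normc0.
have -> : [fset x in (A `|` B)%fset | x \notin A]%fset
        = [fset x in B | x \notin A]%fset.
  by apply/fsetP => i; rewrite !inE/=; case: (i \in A); rewrite ?andbF ?andbT.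
rewrite le_eqVlt; apply/orP; left; apply/eqP.
apply: eq_big_seq => i; rewrite !inE/= => /andP[_ /negPf iA].
by rewrite /restr !fctE iA subr0.
Qed.

End ComplexSums.

(** * Summation by fibres, reindexing, and product families *)

Section Fibres.
Variable R : realType.
Local Notation C := (R[i]).

(** The part of [a] over [j] is extended by zero to all of [I], so that the sums over different
    fibres share one index type. *)
Definition fibre (I J : choiceType) (p : I -> J) (a : I -> C) (j : J) (i : I) : C :=
  if p i == j then a i else 0.

Variables (I J : choiceType) (p : I -> J).
Implicit Types (a b : I -> C).

Lemma fibre_summable a j : asummable a -> asummable (fibre p a j).
Proof.
move=> ha; have [|//] := @asummable_le _ _ (fibre p a j) _ _ ha.
by move=> i /=; rewrite /fibre; case: eqP => // _; rewrite normc0 normc_ge0.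
Qed.

(** After the triangle inequality on each fibre, the finite sum over [B] is exchanged with the
    nonnegative sum over [I]. Each index lies in exactly one fibre, so its modulus is counted at
    most once. *)
Lemma fibre_le a : asummable a ->
  asummable (fun j => csum (fibre p a j)) /\
  rsum (fun j => cabs (csum (fibre p a j))) <= rsum (cabs \o a).
Proof.
move=> ha; apply: rsum_le => [j|B]; first exact: normc_ge0.
apply: le_trans (ler_sum _ (fun j _ => normc_sum_le (fibre_summable j ha))) _.
have n0 j i : 0 <= (cabs \o fibre p a j) i by exact: normc_ge0.
have m0 i : 0 <= (cabs \o a) i by exact: normc_ge0.
rewrite -lee_fin -sumEFin.
under eq_bigr => j _ do rewrite -(esum_rsum (n0 j) (fibre_summable j ha)).
rewrite -esum_sum; last by move=> i j _ _; rewrite lee_fin.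
rewrite -(esum_rsum m0 ha); apply: le_esum => i _.
rewrite sumEFin lee_fin.
have [pB|pB] := boolP (p i \in B).
  rewrite (big_fsetD1 _ pB)/= {1}/fibre eqxx big1_fset ?addr0// => j.
  by rewrite !inE /fibre => /andP[jp _] _; rewrite eq_sym (negPf jp) normc0.
rewrite big1_fset ?normc_ge0// => j jB _; rewrite /= /fibre; case: eqP => [e|_].
  by move: pB; rewrite e jB.
by rewrite normc0.
Qed.

(** A Fubini argument by density: both sides are additive and bounded by the sum of moduli, by
    [fibre_le] and [normc_sum_le], and they agree on finitely supported families, where finite sums
    may be exchanged. *)
Lemma csum_fibre a : asummable a -> csum (fun j => csum (fibre p a j)) = csum a.
Proof.
move=> ha; apply/eqP; rewrite -subr_eq0; apply/eqP; apply: cabs_eq0 => e e0.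
have e20 : 0 < e / 2 by rewrite divr_gt0.
have [A [hA leA]] := csum_tail ha e20.
have [hr sr] := csum_restr A a.
pose F b j := csum (fibre p b j).
have FB b c : asummable b -> asummable c -> F (b - c) = F b - F c.
  move=> hb hc; apply/funext => j; rewrite /F.
  transitivity (csum (fibre p b j) - csum (fibre p c j)); last by [].
  rewrite -(asummableB (fibre_summable j hb) (fibre_summable j hc)).2.
  congr csum; apply/funext => i; rewrite /fibre !fctE.
  by case: ifP; rewrite ?subrr.
have Fr : csum (F (restr A a)) = csum (restr A a).
  have FrE j : F (restr A a) j = \sum_(i <- A) fibre p a j i.
    rewrite /F; have [|_ ->] := @csum_fset _ _ A (fibre p (restr A a) j).
      by move=> i /negPf iA; rewrite /fibre /restr iA; case: ifP.
    by apply: eq_big_seq => i iA; rewrite /fibre /restr iA.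
  have [j jA|_ ->] := @csum_fset _ _ [fset p i | i in A]%fset (F (restr A a)).
    rewrite FrE big1_fset// => i iA _; rewrite /fibre; case: eqP => // pij.
    by move: jA; rewrite -pij in_imfset.
  rewrite sr; under eq_bigr do rewrite FrE.
  rewrite exchange_big/=; apply: eq_big_seq => i iA.
  have piA : p i \in [fset p i | i in A]%fset by rewrite in_imfset.
  rewrite (big_fsetD1 _ piA)/= {1}/fibre eqxx big1_fset ?addr0// => j.
  by rewrite !inE /fibre => /andP[jp _] _; rewrite eq_sym (negPf jp).
have [h1 h2] := fibre_le ha; have [h3 h4] := fibre_le hr.
have [h5 h6] := fibre_le hA; rewrite -/(F _) in h1 h2 h3 h4 h5 h6.
(* The finitely supported part cancels by [Fr]. Each of the two remaining sums is controlled by the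
   tail, hence by [e / 2]. *)
have -> : csum (F a) - csum a = csum (F (a - restr A a)) - csum (a - restr A a).
  rewrite FB// (asummableB ha hr).2 (asummableB h1 h3).2 Fr opprB.
  by rewrite addrA subrK.
apply: le_trans (normc_leD _ _) _; rewrite normcN [e]splitr lerD//.
  by apply: le_trans (normc_sum_le h5) _; apply: le_trans leA.
by apply: le_trans (normc_sum_le hA) _.
Qed.

End Fibres.

(** Summation over the fibres of [h]: injectivity makes each fibre a point or empty, and over an
    empty fibre [a] vanishes by the support hypothesis. *)
Lemma csum_reindex (R : realType) (I J : choiceType) (h : J -> I) (a : I -> R[i]) :
  injective h -> (forall i, a i != 0 -> exists j, i = h j) -> asummable a ->
  asummable (a \o h) /\ csum (a \o h) = csum a.
Proof.
move=> injh supp ha.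
have hah : asummable (a \o h).
  have [|B|//] := @rsum_le _ _ (cabs \o (a \o h)) (rsum (cabs \o a)).
    by move=> j; exact: normc_ge0.
  have injB : {in B &, injective h} by move=> x y _ _; exact: injh.
  rewrite -(big_imfset _ imfset_key (cabs \o a) injB)/=.
  exact: (le_rsum _ (fun i => normc_ge0 (a i)) ha).
split=> //; rewrite -(csum_fibre h hah); congr csum; apply/funext => i.
have [[j ->]|nj] := pselect (exists j, i = h j).
  have [|_ ->] := @csum1 _ _ j (fibre h (a \o h) (h j)); last by rewrite /fibre eqxx.
  by move=> j' jj'; rewrite /fibre (inj_eq injh) (negPf jj').
have -> : fibre h (a \o h) i = 0.
  apply/funext => j; rewrite /fibre; case: eqP => // e.
  by case: nj; exists j.
have -> : a i = 0 by apply/eqP; apply: contra_notT nj => /supp.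
by have [|_ ->] := @csum_fset R _ fset0 (0 : J -> R[i]); rewrite ?big_seq_fset0.
Qed.

(** Serves the tolerances below: an error amplified by [K] is requested as [e / (K + 1)], where the
    [+ 1] keeps the denominator positive when [K] is zero. *)
Lemma mulr_divS_le (R : realType) (K e : R) : 0 <= K -> 0 <= e -> K * (e / (K + 1)) <= e.
Proof.
move=> K0 e0; have K1 : 0 < K + 1 by rewrite ltr_wpDl.
by rewrite mulrCA ler_piMr// ler_pdivrMr// mul1r lerDl.
Qed.

Lemma rsummable_prod (R : realType) (I J : choiceType) (F : I -> R) (G : J -> R) :
  (forall i, 0 <= F i) -> (forall j, 0 <= G j) -> rsummable F -> rsummable G ->
  rsummable (fun p : I * J => F p.1 * G p.2) /\
  rsum (fun p : I * J => F p.1 * G p.2) = rsum F * rsum G.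
Proof.
move=> F0 G0 hF hG.
have E : (\esum_(p in [set: I * J]) (F p.1 * G p.2)%:E = (rsum F * rsum G)%:E)%E.
  have -> : [set: I * J] = [set: I] `*`` (fun=> [set: J]).
    by apply/seteqP; split.
  rewrite -(@esum_esum _ _ _ _ _ (fun i j => (F i * G j)%:E)); last first.
    by move=> i j; rewrite lee_fin mulr_ge0.
  under eq_esum => i _.
    have [h1 h2] := rsumZ (F0 i) G0 hG.
    rewrite (esum_rsum _ h1); last by move=> j; rewrite mulr_ge0.
    rewrite h2 mulrC; over.
  have [h1 h2] := rsumZ (rsum_ge0 G0) F0 hF.
  rewrite (esum_rsum _ h1) ?h2 1?mulrC// => i.
  by rewrite mulr_ge0// rsum_ge0.
by rewrite /rsum /rsummable E ltry.
Qed.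

(** * Pairing with weighted bounded functions, and its behaviour under convolution *)

Section WeightedPairing.
Variables (R : realType) (S : semigroupType) (w : weight R S).
Local Notation C := (R[i]).
Local Notation l1 := (l1 w).
Local Notation "f ** g" := (l1_mul f g) (at level 40, left associativity).
Implicit Types (phi : S -> C) (f g h a b : l1) (A B : {fset S}).

(** Membership in $\ell^\infty(S,\omega)$ with norm at most [M], written without division. *)
Definition wbounded phi (M : R) := 0 <= M /\ forall s, cabs (phi s) <= M * w s.

Lemma weight_ge0 s : 0 <= w s.
Proof. exact/ltW/weight_gt0. Qed.

Lemma cabs_w s : cabs (w s)%:C%C = w s.
Proof. by rewrite normc_real gtr0_norm ?weight_gt0. Qed.

Lemma w_neq0 s : (w s)%:C%C != 0 :> C.
Proof. by rewrite (inj_eq (@complexI R) _ 0) gt_eqF ?weight_gt0. Qed.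

Lemma wabsE (f : S -> C) : wabs w f = cabs \o (fun s => (w s)%:C%C * f s).
Proof. by apply/funext => s; rewrite /wabs /= normcM cabs_w mulrC. Qed.

Lemma l1_norm_ge0 f : 0 <= l1_norm f.
Proof. exact: rsum_ge0 (wabs_ge0 w f). Qed.

Lemma pairing_summable phi M f : wbounded phi M ->
  asummable (fun s => phi s * f s) /\ cabs (pairing phi f) <= M * l1_norm f.
Proof.
move=> [M0 bM]; have [h1 <-] := rsumZ M0 (wabs_ge0 w f) (l1_normP f).
apply: asummable_le h1 => s.
by rewrite normcM /wabs mulrCA mulrC ler_wpM2l ?normc_ge0.
Qed.

Lemma weight_bound phi M s t : wbounded phi M ->
  cabs (phi (s * t)%g) <= M * (w s * w t).
Proof.
move=> [M0 bM]; apply: le_trans (bM _) _.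
by rewrite ler_wpM2l ?weight_submul.
Qed.

(** Submultiplicativity of the weight gives $|\phi(st)|\le M\omega(s)\omega(t)$, so the double
    family is dominated by [M] times the product of the weighted moduli of [f] and [g]. *)
Lemma tensor_summable phi M f g : wbounded phi M ->
  asummable (fun p => phi (p.1 * p.2)%g * (f p.1 * g p.2)) /\
  rsum (cabs \o (fun p => phi (p.1 * p.2)%g * (f p.1 * g p.2))) <=
    M * (l1_norm f * l1_norm g).
Proof.
move=> bM; have [M0 _] := bM.
have [h1 E1] := rsummable_prod (wabs_ge0 w f) (wabs_ge0 w g) (l1_normP f) (l1_normP g).
have [|h2 E2] := rsumZ M0 _ h1; first by move=> p; rewrite mulr_ge0 ?wabs_ge0.
rewrite /l1_norm -E1 -E2; apply: ler_rsum h2 => -[s t] /=; rewrite normc_ge0/=.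
rewrite !normcM /wabs mulrACA [X in M * X]mulrC [leRHS]mulrA.
rewrite ler_wpM2r ?weight_bound//.
by rewrite mulr_ge0 ?normc_ge0.
Qed.

(** The weight is itself a test function: it vanishes nowhere, and it turns sums of moduli into the
    norm of [l1]. *)
Lemma wbounded_w : wbounded (fun s => (w s)%:C%C) 1.
Proof. by split=> // s; rewrite cabs_w mul1r. Qed.

Lemma conv_fibre phi M f g r : wbounded phi M ->
  csum (fibre (fun p => (p.1 * p.2)%g) (fun p => phi (p.1 * p.2)%g * (f p.1 * g p.2)) r)
  = phi r * Defs.conv f g r.
Proof.
move=> bphi.
pose c p := if (p.1 * p.2)%g == r then f p.1 * g p.2 else 0.
have fibreE psi : fibre (fun p => (p.1 * p.2)%g)
    (fun p => psi (p.1 * p.2)%g * (f p.1 * g p.2)) r = psi r *: c.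
  apply/funext => p; rewrite /fibre /c fctE; case: eqP => [<-//|_].
  by rewrite scaler0.
(* Since [phi r] may be zero, summability of [c] is obtained from the test function [w] by dividing
   by [w r]. *)
have cs : asummable c.
  have [h _] := tensor_summable f g wbounded_w.
  have := fibre_summable (fun p => (p.1 * p.2)%g) r h; rewrite (fibreE (fun s => (w s)%:C%C)) => h1.
  have [h2 _] := asummableZ (w r)%:C%C^-1 h1.
  by move: h2; rewrite scalerA mulVf ?scale1r// w_neq0.
by rewrite fibreE (asummableZ (phi r) cs).2.
Qed.

(** With [phi] equal to the weight, the fibre sums of the double family along multiplication are
    $\omega(r)(f*g)(r)$, so [fibre_le] applies. *)
Lemma l1_mul_norm f g : l1_norm (f ** g) <= l1_norm f * l1_norm g.
Proof.
have [h1 h2] := tensor_summable f g wbounded_w.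
have [_ h3] := fibre_le (fun p => (p.1 * p.2)%g) h1.
rewrite mul1r in h2; apply: le_trans h2; apply: le_trans h3.
rewrite /l1_norm wabsE le_eqVlt; apply/orP; left; apply/eqP; congr rsum.
by apply/funext => r; rewrite (conv_fibre _ _ _ wbounded_w).
Qed.

Lemma wbounded_shiftl phi M s : wbounded phi M ->
  wbounded (fun t => phi (s * t)%g) (M * w s).
Proof.
move=> bM; split=> [|t]; first by rewrite mulr_ge0 ?bM.1// weight_ge0.
by rewrite -mulrA weight_bound.
Qed.

Lemma wbounded_shiftr phi M t : wbounded phi M ->
  wbounded (fun s => phi (s * t)%g) (M * w t).
Proof.
move=> bM; split=> [|s]; first by rewrite mulr_ge0 ?bM.1// weight_ge0.
by rewrite -mulrA [_ * w s]mulrC weight_bound.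
Qed.

(** Both sides regroup one absolutely summable family on [S * S]: the left along the product map,
    the right along the first coordinate. Its mirror image uses the second coordinate. *)
Lemma pairing_mull phi M f g : wbounded phi M ->
  pairing phi (f ** g) = pairing (fun s => pairing (fun t => phi (s * t)%g) g) f.
Proof.
move=> bM; have [h _] := tensor_summable f g bM.
transitivity (csum (fun p => phi (p.1 * p.2)%g * (f p.1 * g p.2))).
  rewrite -(csum_fibre (fun p => (p.1 * p.2)%g) h); congr csum.
  by apply/funext => r; rewrite (conv_fibre _ _ _ bM).
rewrite -(csum_fibre fst h); congr csum; apply/funext => s.
have inj : injective (pair s : S -> S * S) by move=> t t' [].
rewrite -(csum_reindex inj _ (fibre_summable _ _ h)).2; last first.
  move=> [s' t]; rewrite /fibre/=; case: (s' =P s) => [->|]; first by exists t.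
  by rewrite eqxx.
have [h' _] := pairing_summable g (wbounded_shiftl s bM).
rewrite mulrC -(asummableZ (f s) h').2; congr csum; apply/funext => t.
by rewrite /fibre/= eqxx mulrCA.
Qed.

Lemma pairing_mulr phi M f g : wbounded phi M ->
  pairing phi (f ** g) = pairing (fun t => pairing (fun s => phi (s * t)%g) f) g.
Proof.
move=> bM; have [h _] := tensor_summable f g bM.
transitivity (csum (fun p => phi (p.1 * p.2)%g * (f p.1 * g p.2))).
  rewrite -(csum_fibre (fun p => (p.1 * p.2)%g) h); congr csum.
  by apply/funext => r; rewrite (conv_fibre _ _ _ bM).
rewrite -(csum_fibre snd h); congr csum; apply/funext => t.
have inj : injective (pair^~ t : S -> S * S) by move=> s s' [].
rewrite -(csum_reindex inj _ (fibre_summable _ _ h)).2; last first.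
  move=> [s t']; rewrite /fibre/=; case: (t' =P t) => [->|]; first by exists s.
  by rewrite eqxx.
have [h' _] := pairing_summable f (wbounded_shiftr t bM).
rewrite mulrC -(asummableZ (g t) h').2; congr csum; apply/funext => s.
by rewrite /fibre/= eqxx/= mulrA [LHS]mulrC.
Qed.

Lemma wbounded_pairingl phi M g : wbounded phi M ->
  wbounded (fun s => pairing (fun t => phi (s * t)%g) g) (M * l1_norm g).
Proof.
move=> bM; split=> [|s]; first by rewrite mulr_ge0 ?bM.1 ?l1_norm_ge0.
by rewrite mulrAC; exact: (pairing_summable g (wbounded_shiftl s bM)).2.
Qed.

Lemma wbounded_pairingr phi M f : wbounded phi M ->
  wbounded (fun t => pairing (fun s => phi (s * t)%g) f) (M * l1_norm f).
Proof.
move=> bM; split=> [|t]; first by rewrite mulr_ge0 ?bM.1 ?l1_norm_ge0.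
by rewrite mulrAC; exact: (pairing_summable f (wbounded_shiftr t bM)).2.
Qed.

Lemma pairing_linear phi M : wbounded phi M -> scalar (pairing phi : l1 -> C).
Proof.
move=> bM c f g.
have [hf _] := pairing_summable f bM; have [hg _] := pairing_summable g bM.
have [hcf <-] := asummableZ c hf; rewrite -(asummableD hcf hg).2.
by congr csum; apply/funext => s; rewrite /= mulrDr mulrCA.
Qed.

Lemma pairing_linearl phi psi M N c f : wbounded phi M -> wbounded psi N ->
  pairing (c *: phi + psi) f = c * pairing phi f + pairing psi f.
Proof.
move=> bM bN.
have [h1 _] := pairing_summable f bM; have [h2 _] := pairing_summable f bN.
have [hc <-] := asummableZ c h1; rewrite -(asummableD hc h2).2.
by congr csum; apply/funext => s; rewrite !fctE mulrDl -[_ *: _ * _]mulrA.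
Qed.

(** A bare function, because it plays two roles: as a test function it evaluates at [s], and as an
    element of [l1] it is the point mass [delta s]. *)
Definition point (s : S) : S -> C := fun t => (t == s)%:R.

Lemma wbounded_point s : wbounded (point s) (w s)^-1.
Proof.
split=> [|t]; first by rewrite invr_ge0 weight_ge0.
rewrite /point; case: eqP => [->|_]; first by rewrite mulVf ?gt_eqF ?weight_gt0 ?normc1.
by rewrite normc0; apply/ltW/mulr_gt0; rewrite ?invr_gt0 weight_gt0.
Qed.

Lemma pairing_point s f : pairing (point s) f = f s.
Proof.
rewrite /pairing; have [|_ ->] := @csum1 _ _ s (fun t => point s t * f t).
  by move=> t /negPf ts; rewrite /point ts mul0r.
by rewrite /point eqxx mul1r.
Qed.

Lemma finite_l1 A (a : S -> C) : (forall s, s \notin A -> a s = 0) ->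
  a \in l1_pred w.
Proof.
move=> aA; apply/l1_predP; rewrite wabsE.
have [|//] := @csum_fset _ _ A (fun s => (w s)%:C%C * a s).
by move=> s /aA ->; rewrite mulr0.
Qed.

Lemma delta_proof s : point s \in l1_pred w.
Proof.
by apply: (@finite_l1 [fset s]%fset) => t; rewrite inE /point => /negPf ->.
Qed.

Definition delta s : l1 := L1 (delta_proof s).

Lemma pairing_delta phi s : pairing phi (delta s) = phi s.
Proof.
rewrite /pairing; have [|_ ->] := @csum1 _ _ s (fun t => phi t * delta s t).
  by move=> t /negPf ts; rewrite /= /point ts mulr0.
by rewrite /= /point eqxx mulr1.
Qed.

Lemma norm_delta_le s : l1_norm (delta s) <= w s.
Proof.
have [|B|//] := @rsum_le _ _ (wabs w (delta s)) (w s); first exact: wabs_ge0.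
have wd t : t != s -> wabs w (delta s) t = 0.
  by rewrite /wabs /= /point => /negPf ->; rewrite normc0 mul0r.
have [sB|sB] := boolP (s \in B).
  rewrite (big_fsetD1 _ sB)/= big1_fset ?addr0.
    by rewrite /wabs /= /point eqxx normc1 mul1r.
  by move=> t; rewrite !inE => /andP[/wd].
rewrite big1_fset ?weight_ge0// => t tB _; apply: wd.
by apply: contraNneq sB => <-.
Qed.

Lemma restr_l1 A f : restr A f \in l1_pred w.
Proof. by apply: (@finite_l1 A) => s /negPf sA; rewrite /restr sA. Qed.

Definition truncate A f : l1 := L1 (restr_l1 A f).

Lemma truncateE A f : truncate A f = \sum_(s <- A) f s *: delta s.
Proof.
apply/val_inj/funext => t /=; rewrite /restr.
have -> : val (\sum_(s <- A) f s *: delta s) t = \sum_(s <- A) f s * point s t.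
  by elim/big_rec2: _ => // s _ y _ <-.
have [tA|tA] := boolP (t \in A).
  rewrite (big_fsetD1 _ tA)/= big1_fset ?addr0; first by rewrite /point eqxx mulr1.
  by move=> s; rewrite !inE /point => /andP[st _] _; rewrite eq_sym (negPf st) mulr0.
rewrite big1_fset// => s sA _; rewrite /point; case: eqP => [e|]; rewrite ?mulr0//.
by move: tA; rewrite e sA.
Qed.

Lemma truncate_approx f (e : R) : 0 < e -> exists A, l1_norm (f - truncate A f) <= e.
Proof.
move=> e0; have hf : asummable (fun s => (w s)%:C%C * f s).
  by have := l1_normP f; rewrite wabsE.
have [A [_ hA]] := csum_tail hf e0; exists A; move: hA; rewrite /l1_norm wabsE.
have -> // : (fun s => (w s)%:C%C * f s) - restr A (fun s => (w s)%:C%C * f s)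
  = (fun s => (w s)%:C%C * (f - truncate A f) s).
apply/funext => s; rewrite !fctE /= /restr !fctE; case: ifP => _.
  by rewrite !subrr mulr0.
by rewrite !subr0.
Qed.

Lemma scalarB (D : l1 -> C) f g : scalar D -> D (f - g) = D f - D g.
Proof. by move=> lD; rewrite addrC -scaleN1r lD mulN1r addrC. Qed.

Lemma scalarZ (D : l1 -> C) c f : scalar D -> D (c *: f) = c * D f.
Proof.
move=> lD; have D0 : D 0 = 0 by rewrite -(subrr 0) scalarB// subrr.
by rewrite -[c *: f]addr0 lD D0 addr0.
Qed.

Lemma scalar_sum (D : l1 -> C) B (F : S -> l1) : scalar D ->
  D (\sum_(s <- B) F s) = \sum_(s <- B) D (F s).
Proof.
move=> lD; elim/big_rec2: _ => [|s y z _ <-].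
  by rewrite -(subrr 0) scalarB// subrr.
by rewrite -[F s]scale1r lD scale1r mul1r.
Qed.

(** [D] and the pairing agree on finite combinations of point masses and both have bound [K], so
    they agree by density of the truncations. *)
Lemma scalar_pairing (D : l1 -> C) (K : R) : 0 <= K -> scalar D ->
  (forall f, cabs (D f) <= K * l1_norm f) ->
  wbounded (fun s => D (delta s)) K /\ D = pairing (fun s => D (delta s)).
Proof.
move=> K0 lD bD; set phi := fun s => D (delta s).
have bphi : wbounded phi K.
  by split=> // s; apply: le_trans (bD _) _; rewrite ler_wpM2l ?norm_delta_le.
have lP := pairing_linear bphi.
split=> //; apply/funext => f; apply/eqP; rewrite -subr_eq0; apply/eqP.
apply: cabs_eq0 => e e0.
(* The tolerance is [e / (K + K + 1)], one [K] for each of the two functionals applied to the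
   error. *)
have [A hA] := truncate_approx f (divr_gt0 e0 (ltr_wpDl (addr_ge0 K0 K0) ltr01)).
set t := truncate A f in hA.
have Dt : D t = pairing phi t.
  rewrite /t truncateE !scalar_sum//; apply: eq_bigr => s _.
  by rewrite !scalarZ// pairing_delta.
have -> : D f - pairing phi f = D (f - t) - pairing phi (f - t).
  by rewrite !scalarB// Dt opprB addrA subrK.
apply: le_trans (normc_leD _ _) _; rewrite normcN.
apply: le_trans (lerD (bD _) (pairing_summable _ bphi).2) _.
rewrite -mulrDl; apply: le_trans (ler_wpM2l (addr_ge0 K0 K0) hA) _.
by rewrite mulr_divS_le ?addr_ge0// ltW.
Qed.

End WeightedPairing.

(** * Functions that vanish at infinity relative to the weight *)

Section Vanishing.
Variables (R : realType) (S : semigroupType) (w : weight R S).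
Local Notation C := (R[i]).
Implicit Types (phi psi : S -> C) (A B : {fset S}).

(** The division-free form of $\phi/\omega\in c_0(S)$; the equivalence is [c0_divwP]. *)
Definition wvanishing phi :=
  forall e : R, 0 < e -> exists A, forall s, s \notin A -> cabs (phi s) <= e * w s.

Lemma cabs_divw phi s : cabs (divw w phi s) = cabs (phi s) / w s.
Proof.
apply: (mulIf (lt0r_neq0 (weight_gt0 w s))); rewrite divfK ?gt_eqF ?weight_gt0//.
by rewrite -[X in _ * X](cabs_w w s) -normcM /divw divfK ?w_neq0.
Qed.

Lemma c0_divwP phi : c0 (divw w phi) <-> wvanishing phi.
Proof.
split=> h e e0.
  have /finite_fsetP[A hA] := h e e0; exists A => s sA.
  rewrite -ler_pdivrMr ?weight_gt0// -cabs_divw leNgt; apply/negP => les.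
  have : [set` A] s by rewrite -hA /= ; apply/negP; rewrite -leNgt ltW.
  by rewrite /= (negPf sA).
(* Halving [e] turns the non-strict bound of [wvanishing] into the strict one of [c0]. *)
have [A hA] := h (e / 2) (divr_gt0 e0 (ltr0Sn _ 1)).
apply: (@sub_finite_set _ _ [set` A]); last exact: finite_fset.
move=> s /= /negP; rewrite -leNgt cabs_divw ler_pdivlMr ?weight_gt0// => les.
apply: contraT => /hA /(le_trans les); rewrite ler_pM2r ?weight_gt0//.
by rewrite ler_pdivlMr// ger_pMr// leNgt ltr1n.
Qed.

(** Off the finite set belonging to tolerance 1 the ratio to the weight is at most 1; on it, the
    ratio is at most the sum of the finitely many ratios. *)
Lemma wvanishing_bounded phi : wvanishing phi -> exists M, wbounded w phi M.
Proof.
move=> /(_ 1 ltr01)[A hA]; pose M := \sum_(s <- A) cabs (phi s) / w s.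
have n0 s : 0 <= cabs (phi s) / w s by rewrite divr_ge0 ?normc_ge0 ?weight_ge0.
have M0 : 0 <= M by apply: sumr_ge0.
exists (1 + M); split=> [|s]; first by rewrite addr_ge0.
have [sA|/hA] := boolP (s \in A); last first.
  by move/le_trans; apply; rewrite ler_wpM2r ?lerDl// weight_ge0.
rewrite -ler_pdivrMr ?weight_gt0// /M (big_fsetD1 _ sA)/= addrCA lerDl.
by rewrite addr_ge0// sumr_ge0.
Qed.

Lemma c0wP phi : c0w w phi <-> wvanishing phi.
Proof.
split=> [[_ /c0_divwP//]|h]; split; last exact/c0_divwP.
have [M [_ hM]] := wvanishing_bounded h.
exists M => _ [s _ <-]; by rewrite cabs_divw ler_pdivrMr ?weight_gt0.
Qed.

Lemma wvanishing_closed phi :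
  (forall e : R, 0 < e -> exists2 psi, wvanishing psi &
     forall s, cabs (phi s - psi s) <= e * w s) -> wvanishing phi.
Proof.
move=> h e e0; have e20 : 0 < e / 2 by rewrite divr_gt0.
have [psi vpsi hpsi] := h _ e20; have [A hA] := vpsi _ e20; exists A => s /hA sA.
rewrite -[phi s](subrK (psi s)) [e]splitr mulrDl.
by apply: le_trans (normc_leD _ _) (lerD _ _).
Qed.

Lemma wvanishingD phi psi : wvanishing phi -> wvanishing psi ->
  wvanishing (phi + psi).
Proof.
move=> h1 h2 e e0; have e20 : 0 < e / 2 by rewrite divr_gt0.
have [A hA] := h1 _ e20; have [B hB] := h2 _ e20; exists (A `|` B)%fset => s.
rewrite inE negb_or => /andP[/hA sA /hB sB]; rewrite [e]splitr mulrDl.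
by apply: le_trans (normc_leD _ _) (lerD _ _).
Qed.

Lemma wvanishingZ c phi : wvanishing phi -> wvanishing (c *: phi).
Proof.
move=> h e e0; have c0 : 0 < cabs c + 1 by rewrite ltr_wpDl ?normc_ge0.
have [A hA] := h _ (divr_gt0 e0 c0); exists A => s /hA.
rewrite mulrAC ler_pdivlMr// mulrC => /(le_trans _); apply.
by rewrite normcM ler_wpM2r ?normc_ge0// lerDl.
Qed.

Lemma wvanishing_finite A phi : (forall s, s \notin A -> phi s = 0) ->
  wvanishing phi.
Proof.
move=> h e e0; exists A => s /h ->.
by rewrite normc0 mulr_ge0 ?weight_ge0// ltW.
Qed.

Lemma wvanishing_sum (I : Type) (r : seq I) (F : I -> S -> C) :
  (forall i, wvanishing (F i)) -> wvanishing (\sum_(i <- r) F i).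
Proof.
move=> h; elim/big_ind: _ => //; last by move=> *; exact: wvanishingD.
exact: (@wvanishing_finite fset0).
Qed.

Lemma restr_sum A phi : restr A phi = \sum_(s <- A) phi s *: point R s.
Proof.
apply/funext => t; rewrite fct_sumE /restr.
have [tA|tA] := boolP (t \in A).
  rewrite (big_fsetD1 _ tA)/= big1_fset ?addr0.
    by rewrite !fctE /point eqxx [_ *: _]mulr1.
  move=> s; rewrite !inE !fctE /point => /andP[st _] _.
  by rewrite eq_sym (negPf st) scaler0.
rewrite big1_fset// => s sA _; rewrite !fctE /point; case: eqP => [e|_]; last first.
  by rewrite scaler0.
by move: tA; rewrite e sA.
Qed.

(** Density of the finitely supported functions in $c_0(S,\omega)$. *)
Lemma wvanishing_restr phi (e : R) : wvanishing phi -> 0 < e ->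
  exists A, wbounded w (phi - restr A phi) e.
Proof.
move=> h e0; have [A hA] := h e e0; exists A; split=> [|s]; first exact: ltW.
rewrite !fctE /restr; case: ifPn => [sA|/hA]; last by rewrite subr0.
by rewrite subrr normc0 mulr_ge0 ?weight_ge0// ltW.
Qed.

End Vanishing.

Lemma lipschitz_topdual (R : realType) (A : completeNormedModType R[i])
    (D : A -> R[i]) (K : R) : scalar D ->
  (forall a, (cabs (D a))%:C%C <= K%:C%C * `|a|) -> topdual D.
Proof.
move=> lD bD; split=> // a.
have K0 : 0 < `|K| + 1 by rewrite ltr_wpDl.
apply/cvgrPdist_lt => e e0; apply/nbhs_ballP; exists (e / (`|K| + 1)%:C%C) => /=.
  by rewrite divr_gt0// (ltcR 0).
move=> b; rewrite -ball_normE/= ltr_pdivlMr ?(ltcR 0)// mulrC; apply: le_lt_trans.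
have -> : D a - D b = D (a - b) by rewrite [a - b]addrC -[- b]scaleN1r lD mulN1r addrC.
apply: le_trans (bD _) _; rewrite ler_wpM2r// lecR'.
by apply: le_trans (ler_norm _) _; rewrite lerDl.
Qed.

(** * Bounded functionals on [l1], and closedness of the candidate predual *)

Section Predual.
Variables (R : realType) (S : semigroupType) (w : weight R S).
Local Notation C := (R[i]).
Local Notation l1 := (l1 w).
Implicit Types (phi psi : S -> C) (f g a b : l1) (D : l1 -> C).
Local Notation pairing := (@Defs.pairing R S w).
Local Notation X := (c0w_functionals w).

Lemma l1_norm_le1 f : (`|f| <= 1) = (l1_norm f <= 1).
Proof. by rewrite l1_normE -(lecR' (l1_norm f) 1). Qed.

Lemma l1_normZ (c : C) f : l1_norm (c *: f) = cabs c * l1_norm f.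
Proof. by apply: complexI; rewrite rmorphM; exact: (normrZ c f). Qed.

Lemma l1_norm_eq0 f : l1_norm f = 0 -> f = 0.
Proof. by move=> h; apply: l1_normr0_eq0; rewrite /l1_normC h. Qed.

Lemma topdual_bounded D : topdual D ->
  exists2 K : R, 0 <= K & forall f, cabs (D f) <= K * l1_norm f.
Proof.
move=> [lD cD].
have D0 : D 0 = 0 by rewrite -(subrr 0) scalarB// subrr.
have /cvgrPdist_lt/(_ 1 ltr01)/nbhs_ballP[_ /gt0_complexP[d d0 ->] hd] := cD 0.
exists (2 / d) => [|f]; first by rewrite divr_ge0 // ltW.
have [/l1_norm_eq0 ->|fn0] := eqVneq (l1_norm f) 0.
  by rewrite D0 normc0 mulr_ge0 ?l1_norm_ge0// divr_ge0// ltW.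
have fp : 0 < l1_norm f by rewrite lt_neqAle eq_sym fn0 l1_norm_ge0.
(* Rescaling by [c] brings [f] to norm [d / 2], inside the ball on which [D] stays below 1; undoing
   it yields the constant [2 / d]. *)
pose c := d / (2 * l1_norm f); have c0 : 0 < c by rewrite divr_gt0// mulr_gt0.
have cc : cabs c%:C%C = c by rewrite normc_real gtr0_norm.
have {}hd : c * cabs (D f) < 1.
  have : (cabs (D 0 - D (c%:C%C *: f)))%:C%C < 1%:C%C :> C.
    apply: hd; rewrite -ball_normE/= sub0r normrN l1_normE ltcR l1_normZ cc.
    rewrite /c invfM mulrA divfK//.
    by rewrite ltr_pdivrMr// ltr_pMr// ltr1n.
  by rewrite ltcR D0 sub0r normcN scalarZ// normcM cc.
move: hd; rewrite -ltr_pdivlMl// mulr1 /c invfM invrK => /ltW /le_trans; apply.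
by rewrite mulrA mulrAC mulrC mulrA.
Qed.

Lemma bounded_topdual D (K : R) : scalar D ->
  (forall f, cabs (D f) <= K * l1_norm f) -> topdual D.
Proof.
move=> lD bD; apply: (@lipschitz_topdual _ _ _ K lD) => f.
by rewrite l1_normE -rmorphM lecR'.
Qed.

Lemma opnorm_le D (K : R) : 0 <= K ->
  (forall f, cabs (D f) <= K * l1_norm f) -> opnorm D <= K.
Proof.
move=> K0 bD; apply: ge_sup.
  by exists (cabs (D 0)); exists 0 => //=; rewrite normr0.
move=> _ [f /= + <-]; rewrite l1_norm_le1 => f1.
by apply: le_trans (bD _) _; rewrite ler_piMr.
Qed.

Lemma opnorm_ub D f : topdual D -> l1_norm f <= 1 -> cabs (D f) <= opnorm D.
Proof.
move=> tD f1; have [K K0 bD] := topdual_bounded tD; apply: ub_le_sup.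
  exists K => _ [g /= + <-]; rewrite l1_norm_le1 => g1.
  by apply: le_trans (bD _) _; rewrite ler_piMr.
by exists f => //=; rewrite l1_norm_le1.
Qed.

Lemma opnorm_ge0 D : topdual D -> 0 <= opnorm D.
Proof.
move=> tD; apply: le_trans (normc_ge0 (D 0)) (opnorm_ub tD _).
by rewrite -l1_norm_le1 normr0.
Qed.

Lemma le_opnorm D f : topdual D -> cabs (D f) <= opnorm D * l1_norm f.
Proof.
move=> tD; have [lD _] := tD.
have [/l1_norm_eq0 ->|fn0] := eqVneq (l1_norm f) 0.
  have -> : D 0 = 0 by rewrite -(subrr 0) scalarB// subrr.
  by rewrite normc0 mulr_ge0 ?l1_norm_ge0// opnorm_ge0.
have fp : 0 < l1_norm f by rewrite lt_neqAle eq_sym fn0 l1_norm_ge0.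
have cV : cabs (l1_norm f)^-1%:C%C = (l1_norm f)^-1.
  by rewrite normc_real gtr0_norm ?invr_gt0.
rewrite -ler_pdivrMr// mulrC -cV -normcM -scalarZ//; apply: opnorm_ub => //.
by rewrite l1_normZ cV mulVf.
Qed.

Lemma pairing_topdual phi M : wbounded w phi M ->
  topdual (pairing phi) /\ opnorm (pairing phi) <= M.
Proof.
move=> bM; split.
  apply: (bounded_topdual (pairing_linear bM)) => f.
  exact: (pairing_summable f bM).2.
by apply: opnorm_le bM.1 _ => f; exact: (pairing_summable f bM).2.
Qed.

(** The dual of [l1] is $\ell^\infty(S,\omega)$. The explicit bound [opnorm D] lets norm estimates
    on functionals be read off as weighted pointwise estimates. *)
Lemma topdual_pairing D : topdual D ->
  wbounded w (fun s => D (delta w s)) (opnorm D) /\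
  D = pairing (fun s => D (delta w s)).
Proof.
move=> tD; apply: scalar_pairing tD.1 _ => [|f]; last exact: le_opnorm.
exact: opnorm_ge0.
Qed.

Lemma c0w_functionalsP D : X D <-> exists2 phi, wvanishing w phi & D = pairing phi.
Proof.
split=> [[phi /c0wP h <-]|[phi h ->]]; first by exists phi.
by exists phi => //; apply/c0wP.
Qed.

Lemma c0w_functionals_point phi : X (pairing phi) -> wvanishing w phi.
Proof.
move=> /c0w_functionalsP[psi h e]; suff -> : phi = psi by [].
by apply/funext => s; rewrite -(pairing_delta w phi) e pairing_delta.
Qed.

Lemma c0w_functionals_linear (c : C) D E : X D -> X E -> X (c *: D + E).
Proof.
move=> /c0w_functionalsP[phi hphi ->] /c0w_functionalsP[psi hpsi ->].
apply/c0w_functionalsP; exists (c *: phi + psi).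
  by apply: wvanishingD => //; exact: wvanishingZ.
have [M bM] := wvanishing_bounded hphi; have [N bN] := wvanishing_bounded hpsi.
by apply/funext => f; rewrite (pairing_linearl _ _ bM bN).
Qed.

Lemma pairing0 : pairing 0 = 0.
Proof.
apply/funext => f; rewrite /Defs.pairing.
have [|_ ->] := @csum_fset R _ fset0 (fun s => (0 : S -> C) s * f s).
  by move=> s _; rewrite mul0r.
by rewrite big_seq_fset0.
Qed.

Lemma c0w_functionals_closed : closed_subspace X.
Proof.
split.
- move=> D /c0w_functionalsP[phi /wvanishing_bounded[M bM] ->].
  exact: (pairing_topdual bM).1.
- apply/c0w_functionalsP; exists 0; last by rewrite pairing0.
  exact: (@wvanishing_finite _ _ _ fset0).
- by move=> c D E; exact: c0w_functionals_linear.
- move=> D tD hD; apply/c0w_functionalsP.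
  exists (fun s => D (delta w s)); last exact: (topdual_pairing tD).2.
  (* Closeness in operator norm becomes weighted uniform closeness of the representing functions,
     which preserves vanishing at infinity. *)
  apply: wvanishing_closed => e /hD[E XE DE].
  have [psi hpsi EE] := (c0w_functionalsP E).1 XE; exists psi => // s.
  have [N bN] := wvanishing_bounded hpsi.
  have [tE _] := pairing_topdual bN.
  have [K _ bK] := topdual_bounded tD.
  have tDE : topdual (D - E).
    apply: (@bounded_topdual _ (K + N)) => [c f g|f].
      by rewrite !fctE EE tD.1 tE.1 mulrBr opprD addrACA.
    rewrite mulrDl; apply: le_trans (normc_leD _ _) _; rewrite normcN EE.
    by apply: lerD => //; exact: (pairing_summable f bN).2.
  have := (topdual_pairing tDE).1.2 s; rewrite EE !fctE pairing_delta => /le_trans; apply.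
  by rewrite -EE ler_wpM2r ?weight_ge0// ltW.
Qed.

End Predual.

(** * Duality between $c_0(S,\omega)$ and [l1], and the Banach algebra axioms *)

Section PredualDuality.
Variables (R : realType) (S : semigroupType) (w : weight R S).
Local Notation C := (R[i]).
Local Notation l1 := (l1 w).
Implicit Types (phi psi : S -> C) (f g a b : l1) (D : l1 -> C).
Local Notation pairing := (@Defs.pairing R S w).
Local Notation X := (c0w_functionals w).

(** The multiple of the weight by the conjugate phase of [a], so that its product with [a] is the
    weighted modulus. Where [a] vanishes, division by zero makes the value zero. *)
Definition phase (a : S -> C) : S -> C :=
  fun s => (w s)%:C%C * ((cabs (a s))%:C%C / a s).

Lemma phaseM (a : S -> C) s : phase a s * a s = (wabs w a s)%:C%C.
Proof.
rewrite /phase /wabs; have [as0|as0] := eqVneq (a s) 0.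
  by rewrite as0 mulr0 normc0 mul0r.
by rewrite -mulrA divfK// -rmorphM mulrC.
Qed.

Lemma wbounded_phase B (a : S -> C) : wbounded w (restr B (phase a)) 1.
Proof.
split=> // s; rewrite mul1r /restr /phase; case: ifP => _; last first.
  by rewrite normc0 weight_ge0.
rewrite normcM cabs_w ler_piMr ?weight_ge0//.
have [->|as0] := eqVneq (a s) 0; first by rewrite invr0 mulr0 normc0.
have as1 : 0 < cabs (a s).
  by rewrite lt_neqAle eq_sym normc_ge0 andbT; apply: contra_neq as0 => /eq0_normc.
by rewrite -(ler_pM2r as1) -normcM divfK// normc_real ger0_norm ?normc_ge0// mul1r.
Qed.

Lemma wvanishing_restrT B phi : wvanishing w (restr B phi).
Proof.
by apply: (@wvanishing_finite _ _ _ B) => s /negPf; rewrite /restr => ->.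
Qed.

Lemma pairing_restr B phi f : pairing (restr B phi) f = \sum_(s <- B) phi s * f s.
Proof.
rewrite /Defs.pairing; have [|_ ->] := @csum_fset _ _ B (fun s => restr B phi s * f s).
  by move=> s /negPf; rewrite /restr => ->; rewrite mul0r.
by apply: eq_big_seq => s sB; rewrite /restr sB.
Qed.

(** The upper bound is [le_opnorm]. For the lower one, the phase cut off to a finite set [B] lies in
    the unit ball of the predual and pairs with [a] to the part of the norm carried by [B]. *)
Lemma l1_norm_dual a :
  l1_norm a = sup [set cabs (D a) | D in [set D | X D /\ opnorm D <= 1]].
Proof.
have ub : ubound [set cabs (D a) | D in [set D | X D /\ opnorm D <= 1]] (l1_norm a).
  move=> _ [D /= [XD D1] <-]; have tD : topdual D.
    by have [h _ _ _] := c0w_functionals_closed w; exact: h.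
  by apply: le_trans (le_opnorm a tD) _; rewrite ler_piMl ?l1_norm_ge0.
apply/le_anti/andP; split; last first.
  apply: ge_sup => //; exists 0; exists (pairing 0) => /=; last by rewrite pairing0 normc0.
  split; first by rewrite pairing0; have [] := c0w_functionals_closed w.
  rewrite pairing0; apply: opnorm_le => // f.
  by rewrite normc0 mul1r l1_norm_ge0.
apply/ler_addgt0Pr => e e0; rewrite -lerBlDr.
have [B hB] := rsum_gt (wabs_ge0 w a) (l1_normP a) e0.
apply: le_trans (ltW hB) _; apply: ub_le_sup; first by exists (l1_norm a).
exists (pairing (restr B (phase a))).
  split.
    by apply/c0w_functionalsP; exists (restr B (phase a)) => //; exact: wvanishing_restrT.
  exact: (pairing_topdual (wbounded_phase B a)).2.
rewrite pairing_restr; under eq_bigr do rewrite phaseM.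
by rewrite -rmorph_sum normc_real ger0_norm// sumr_ge0// => s _; exact: wabs_ge0.
Qed.

Lemma functional_restr (L : (l1 -> C) -> C) A phi :
  (forall (c : C) D E, X D -> X E -> L (c *: D + E) = c * L D + L E) ->
  L (pairing (restr A phi)) = \sum_(s <- A) phi s * L (pairing (point R s)).
Proof.
move=> linL; rewrite restr_sum.
have Xp s : X (pairing (point R s)).
  apply/c0w_functionalsP; exists (point R s) => //.
  apply: (@wvanishing_finite _ _ _ [fset s]%fset) => t.
  by rewrite inE /point => /negPf ->.
have X0 : X 0 by have [] := c0w_functionals_closed w.
have L0 : L 0 = 0.
  by have /eqP := linL 1 0 0 X0 X0; rewrite scaler0 addr0 mul1r -subr_eq subrr => /eqP.
(* Linearity of [L] is available only on [X], so membership in [X] is carried through the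
   induction. *)
suff [] : X (pairing (\sum_(s <- A) phi s *: point R s)) /\
  L (pairing (\sum_(s <- A) phi s *: point R s))
  = \sum_(s <- A) phi s * L (pairing (point R s)) by [].
elim: (enum_fset A) => [|s r [IH1 IH2]]; first by rewrite !big_nil pairing0.
rewrite !big_cons.
have [M bM] := wvanishing_bounded (c0w_functionals_point IH1).
have -> : pairing (phi s *: point R s + \sum_(j <- r) phi j *: point R j) =
  phi s *: pairing (point R s) + pairing (\sum_(j <- r) phi j *: point R j).
  by apply/funext => f; rewrite (pairing_linearl _ _ (wbounded_point w s) bM).
by split; [exact: c0w_functionals_linear|rewrite linL// IH2].
Qed.

(** The candidate [a] collects the values of [L] on the coordinate functionals. Testing [L] on
    cut-off phases of [a] bounds its norm, and density of finite support extends the identity to all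
    of [X]. *)
Lemma c0w_functionals_dual (L : (l1 -> C) -> C) : bounded_functional_on X L ->
  exists a, forall D, X D -> L D = D a.
Proof.
move=> [linL [M0 bL0]]; pose M := `|M0|; have Mge0 : 0 <= M by exact: normr_ge0.
have tX D : X D -> topdual D.
  by have [h _ _ _] := c0w_functionals_closed w; exact: h.
have bL D : X D -> cabs (L D) <= M * opnorm D.
  move=> XD; apply: le_trans (bL0 D XD) _.
  by rewrite ler_wpM2r ?ler_norm// opnorm_ge0//; exact: tX.
have Xr B phi : X (pairing (restr B phi)).
  by apply/c0w_functionalsP; exists (restr B phi) => //; exact: wvanishing_restrT.
pose a s := L (pairing (point R s)).
have la : a \in l1_pred w.
  apply/l1_predP; have [|B|//] := @rsum_le _ _ (wabs w a) M; first exact: wabs_ge0.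
  rewrite -[leLHS]ger0_norm ?sumr_ge0//; last by move=> s _; exact: wabs_ge0.
  rewrite -normc_real rmorph_sum.
  under eq_bigr do rewrite /= -phaseM.
  rewrite -functional_restr//; apply: le_trans (bL _ (Xr _ _)) _.
  by rewrite ler_piMr//; exact: (pairing_topdual (wbounded_phase B a)).2.
exists (L1 la) => D XD; apply/eqP; rewrite -subr_eq0; apply/eqP.
apply: cabs_eq0 => e e0.
have K0 : 0 <= M + l1_norm (L1 la) by rewrite addr_ge0 ?l1_norm_ge0.
have [phi vphi DE] := (c0w_functionalsP D).1 XD.
(* The truncation error is amplified by [M] under [L] and by the norm of [a] under evaluation,
   whence the denominator. *)
have [A hA] := wvanishing_restr vphi (divr_gt0 e0 (ltr_wpDl K0 ltr01)).
have [N bN] := wvanishing_bounded vphi.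
have [N' bN'] := wvanishing_bounded (wvanishing_restrT A phi).
(* The difference is put in the shape [c *: f + g] in which linearity of [L] is given. *)
have XB : pairing (phi - restr A phi) = - 1 *: pairing (restr A phi) + D.
  apply/funext => f; rewrite [phi - _]addrC -[- restr A phi]scaleN1r.
  by rewrite (pairing_linearl _ _ bN' bN) DE.
have -> : L D - D (L1 la) = L (pairing (phi - restr A phi)) - pairing (phi - restr A phi) (L1 la).
  rewrite XB linL// functional_restr// !fctE pairing_restr.
  by rewrite mulN1r scaleN1r opprD opprK addrACA addNr add0r.
have XX : X (pairing (phi - restr A phi)).
  by rewrite XB; exact: c0w_functionals_linear.
have [_ opn] := pairing_topdual hA.
apply: le_trans (normc_leD _ _) _; rewrite normcN.
apply: le_trans (lerD (bL _ XX) (pairing_summable _ hA).2) _.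
apply: (@le_trans _ _ ((M + l1_norm (L1 la)) * (e / (M + l1_norm (L1 la) + 1)))).
  by rewrite mulrDl lerD ?ler_wpM2l// mulrC.
by rewrite mulr_divS_le// ltW.
Qed.

Lemma c0w_is_predual : is_predual X.
Proof.
split; [exact: c0w_functionals_closed|exact: l1_norm_dual|].
exact: c0w_functionals_dual.
Qed.

(** Reduces the algebra identities to test functions, where [pairing_mull] and [pairing_mulr]
    replace the convolution by iterated pairings. *)
Lemma l1_ext f g : (forall s, pairing (point R s) f = pairing (point R s) g) -> f = g.
Proof.
by move=> h; apply/val_inj/funext => s; have := h s; rewrite !pairing_point.
Qed.

Lemma l1_banach_algebra : is_banach_algebra (@l1_mul R S w).
Proof.
split=> [f g h|f c g h|h c f g|f g].
- apply: l1_ext => r; have b := wbounded_point w r.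
  rewrite (pairing_mull _ _ b) [RHS](pairing_mull _ _ b).
  rewrite [RHS](pairing_mull _ _ (wbounded_pairingl h b)).
  congr (Defs.pairing _ f); apply/funext => s.
  rewrite (pairing_mull _ _ (wbounded_shiftl s b)).
  congr (Defs.pairing _ g); apply/funext => t.
  by congr (Defs.pairing _ h); apply/funext => u; rewrite mulgA.
- apply: l1_ext => r; have b := wbounded_point w r.
  rewrite (pairing_linear b) !(pairing_mulr _ _ b).
  exact: pairing_linear (wbounded_pairingr f b) c g h.
- apply: l1_ext => r; have b := wbounded_point w r.
  rewrite (pairing_linear b) !(pairing_mull _ _ b).
  exact: pairing_linear (wbounded_pairingl h b) c f g.
- by rewrite !l1_normE -rmorphM lecR' l1_mul_norm.
Qed.

End PredualDuality.

(** * Translates of test functions and the submodule condition *)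

Section Translates.
Variables (R : realType) (S : semigroupType) (w : weight R S).
Local Notation C := (R[i]).
Local Notation l1 := (l1 w).
Local Notation pairing := (@Defs.pairing R S w).
Local Notation X := (c0w_functionals w).

(* [m] is the product of [S] or its opposite, so that both module actions are
   covered at once. *)
Lemma wvanishing_translate (m : S -> S -> S) (phi : S -> C) (a : l1) :
  (forall s t, w (m s t) <= w s * w t) ->
  (forall r t, wvanishing w (fun s => point R r (m s t))) ->
  wvanishing w phi -> wvanishing w (fun s => pairing (fun t => phi (m s t)) a).
Proof.
move=> wm hm vphi; apply: wvanishing_closed => e e0.
have e20 : 0 < e / 2 by rewrite divr_gt0.
have shift psi M s : wbounded w psi M -> wbounded w (fun t => psi (m s t)) (M * w s).
  move=> [M0 bM]; split=> [|t]; first by rewrite mulr_ge0// weight_ge0.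
  by apply: le_trans (bM _) _; rewrite -mulrA ler_wpM2l.
have [M bM] := wvanishing_bounded vphi.
(* First [phi] is cut off, with an error that pairing with [a] amplifies by the norm of [a]; then
   [a] is cut off, with an error amplified by the bound [N] of the truncated [phi]. Each costs
   [e / 2]. *)
have [A hA] := wvanishing_restr vphi (divr_gt0 e20 (ltr_wpDl (l1_norm_ge0 a) ltr01)).
pose psi := restr A phi.
have [N bN] := wvanishing_bounded (wvanishing_restrT w A phi).
have N0 := bN.1.
have [B hB] := truncate_approx a (divr_gt0 e20 (ltr_wpDl N0 ltr01)).
exists (fun s => pairing (fun t => psi (m s t)) (truncate B a)).
  (* With both arguments finite, the function is a finite combination of translates of points, each
     vanishing at infinity by hypothesis. *)
  have -> : (fun s => pairing (fun t => psi (m s t)) (truncate B a)) =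
      \sum_(t <- B) a t *: \sum_(r <- A) phi r *: (fun s => point R r (m s t)).
    apply/funext => s; rewrite fct_sumE truncateE.
    have lP := pairing_linear (shift _ _ s bN); rewrite scalar_sum//.
    apply: eq_bigr => t _; rewrite scalarZ// pairing_delta /psi restr_sum.
    by rewrite !fctE !fct_sumE.
  by apply: wvanishing_sum => t; apply/wvanishingZ/wvanishing_sum => r; exact: wvanishingZ.
move=> s; rewrite -/psi in hA bN; set p := fun t => phi (m s t); set q := fun t => psi (m s t).
have bp : wbounded w p _ := shift _ _ s bM.
have bq : wbounded w q _ := shift _ _ s bN.
have bpq : wbounded w (fun t => (phi - psi) (m s t)) _ := shift _ _ s hA.
have -> : pairing p a - pairing q (truncate B a) =
    pairing (fun t => (phi - psi) (m s t)) a + pairing q (a - truncate B a).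
  have -> : (fun t => (phi - psi) (m s t)) = -1 *: q + p.
    by rewrite scaleN1r addrC.
  rewrite (pairing_linearl _ _ bq bp) (scalarB _ _ (pairing_linear bq)).
  by rewrite mulN1r addrACA addNr add0r.
apply: le_trans (normc_leD _ _) _; rewrite [e]splitr mulrDl; apply: lerD.
  apply: le_trans (pairing_summable _ bpq).2 _.
  rewrite mulrAC ler_wpM2r ?weight_ge0//.
  by rewrite mulrC mulr_divS_le ?l1_norm_ge0// ltW.
apply: le_trans (pairing_summable _ bq).2 _.
rewrite mulrAC ler_wpM2r ?weight_ge0//.
apply: le_trans (ler_wpM2l N0 hB) _.
by rewrite mulr_divS_le// ltW.
Qed.

Lemma pairing_delta_mul (phi : S -> C) M s t : wbounded w phi M ->
  pairing phi (l1_mul (delta w s) (delta w t)) = phi (s * t)%g.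
Proof. by move=> bM; rewrite (pairing_mull _ _ bM) !pairing_delta. Qed.

Lemma indic_rquot s t : \1_(rquot s t) = (fun r : S => point R s (r * t)%g).
Proof.
apply/funext => r; rewrite indicE /point; congr (_%:R); congr nat_of_bool.
by apply/idP/eqP; rewrite inE.
Qed.

Lemma indic_lquot s t : \1_(lquot t s) = (fun r : S => point R s (t * r)%g).
Proof.
apply/funext => r; rewrite indicE /point; congr (_%:R); congr nat_of_bool.
by apply/idP/eqP; rewrite inE.
Qed.

(** Necessity: acting by [delta t] on the functional of [point R s] and evaluating at [delta r]
    gives the translated point. Sufficiency: the actions on the functional of [phi] are the iterated
    pairings of [pairing_mull] and [pairing_mulr], to which [wvanishing_translate] applies. *)
Lemma submodule_c0w_functionalsP :
  (forall a D, X D -> X (lact (@l1_mul R S w) a D) /\ X (ract (@l1_mul R S w) D a)) <->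
  (forall s t : S, wvanishing w (fun r => point R s (r * t)%g) /\
                   wvanishing w (fun r => point R s (t * r)%g)).
Proof.
split=> [h s t|h a D /c0w_functionalsP[phi vphi ->]].
  have bs := wbounded_point w s.
  have Xs : X (pairing (point R s)).
    apply/c0w_functionalsP; exists (point R s) => //.
    apply: (@wvanishing_finite _ _ _ [fset s]%fset) => u.
    by rewrite inE /point => /negPf ->.
  have [/c0w_functionalsP[phi vphi phiE] /c0w_functionalsP[psi vpsi psiE]] :=
    h (delta w t) _ Xs.
  split.
    suff -> : (fun r => point R s (r * t)%g) = phi by [].
    apply/funext => r; rewrite -(pairing_delta_mul _ _ bs) -(pairing_delta w phi).
    by rewrite -phiE.
  suff -> : (fun r => point R s (t * r)%g) = psi by [].
  apply/funext => r; rewrite -(pairing_delta_mul _ _ bs) -(pairing_delta w psi).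
  by rewrite -psiE.
have [M bM] := wvanishing_bounded vphi.
split; apply/c0w_functionalsP.
  exists (fun s => pairing (fun t => phi (s * t)%g) a).
    apply: (@wvanishing_translate (fun s t => (s * t)%g)) => // [s t|r t].
      exact: weight_submul.
    exact: (h r t).1.
  by apply/funext => b; rewrite -(pairing_mull _ _ bM).
exists (fun t => pairing (fun s => phi (s * t)%g) a).
  (* The right action uses the opposite product, for which the weight is still submultiplicative
     because real multiplication commutes. *)
  apply: (@wvanishing_translate (fun t s => (s * t)%g)) => // [s t|r t].
    by rewrite mulrC weight_submul.
  exact: (h r t).2.
by apply/funext => b; rewrite -(pairing_mulr _ _ bM).
Qed.

End Translates.

Theorem corollary2p4 (R : realType) (S : semigroupType) (w : weight R S) :
  dual_banach_algebra (@l1_mul R S w) (c0w_functionals w) <->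
  forall s t : S,
    c0 (divw w (\1_(rquot s t) : S -> R[i])) /\
    c0 (divw w (\1_(lquot t s) : S -> R[i])).
Proof.
have E : (forall s t : S, c0 (divw w (\1_(rquot s t) : S -> R[i])) /\
    c0 (divw w (\1_(lquot t s) : S -> R[i]))) <->
  (forall s t : S, wvanishing w (fun r => point R s (r * t)%g) /\
                   wvanishing w (fun r => point R s (t * r)%g)).
  split=> h s t; have [h1 h2] := h s t; rewrite indic_rquot indic_lquot in h1 h2 *.
    by split; exact/c0_divwP.
  by split; exact/c0_divwP.
(* The Banach algebra axioms and the predual property hold for every weight, so the equivalence
   rests on the submodule condition. *)
rewrite E -submodule_c0w_functionalsP; split=> [[]//|h].
by split; [exact: l1_banach_algebra|exact: c0w_is_predual|].
Qed.
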